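(* Consider DSGT with time-varying stepsizes under the assumptions (A1)--(A4) described in the context, with stepsize $\alpha_k:=\theta/(m+k)$, where $\theta>1/\mu$ and $m$ satisfies $$m>\max\left\{\frac{\theta}{2}(\mu+L),\ \frac{4\theta L\rho_w^2+2\theta L\rho_w\sqrt{1+3\rho_w^2}}{1-\rho_w^2}\right\}$$ and $$\frac{(1-\rho_w^2)^2}{\theta^2(1+\rho_w^2)\rho_w^2}\left[\frac{1-\rho_w^2}{2}-\frac{2m+1}{(m+1)^2}\right]>\frac{1}{\theta\mu-1}\left(\frac1\mu+\frac{\theta}{m}\right)\frac{4\theta^2L^5}{m^3}+\frac{2C}{m^2},$$ with $$C=\left[\left(\frac{1-\rho_w^2}{2\rho_w^2}-\frac{4\theta L}{m}-\frac{2\theta^2L^2}{m^2}\right)^{-1}+2\right]\|\mathbf{W}-\mathbf{I}\|^2L^2+\frac{3\theta L^3}{m}.$$ Then there exist constants $c_1,c_2,c_3$ that do not depend on $k$ such that for all $k\ge0$, $$\mathbb{E}[\|\overline{x}_k-x^*\|^2]\le\frac{2\theta^2\sigma^2}{n(\theta\mu-1)(m+k)}+\frac{c_1}{(m+k)^{\theta\mu}}+\frac{c_2}{(m+k)^2},\qquad \mathbb{E}[\|\mathbf{x}_k-\mathbf{1}\overline{x}_k\|^2]\le\frac{c_3}{(m+k)^2}.$$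
   Context: Setting (DSGT with time-varying stepsizes). There are $n$ agents $\mathcal{N}=\{1,\dots,n\}$, with local cost functions $f_i:\mathbb{R}^p\to\mathbb{R}$, and $f=\frac1n\sum_{i=1}^nf_i$. Assumptions: (A1) Stochastic gradients: $g_i(x,\xi)$ is a (measurable) function of $x\in\mathbb{R}^p$, $\xi$ in a Euclidean space; the random vectors $\xi_{i,k}$ ($i\in\mathcal{N}$, $k\ge0$) are independent across agents and iterations, and for some $\sigma>0$, for all $i,k$ and all $x\in\mathbb{R}^p$, $\mathbb{E}[g_i(x,\xi_{i,k})]=\nabla f_i(x)$ and $\mathbb{E}[\|g_i(x,\xi_{i,k})-\nabla f_i(x)\|^2]\le\sigma^2$. (A2) Each $f_i$ is $\mu$-strongly convex with $L$-Lipschitz gradient ($\mu,L>0$): $\langle\nabla f_i(x)-\nabla f_i(x'),x-x'\rangle\ge\mu\|x-x'\|^2$ and $\|\nabla f_i(x)-\nabla f_i(x')\|\le L\|x-x'\|$ for all $x,x'$. Let $x^*$ be the unique minimizer of $f$. (A3) The communication graph $\mathcal{G}$ on $\mathcal{N}$ is undirected and connected. (A4) $\mathbf{W}=[w_{ij}]\in\mathbb{R}^{n\times n}$ is nonnegative and doubly stochastic ($\mathbf{W}\mathbf{1}=\mathbf{1}$, $\mathbf{1}^\top\mathbf{W}=\mathbf{1}^\top$), with $w_{ii}>0$ for some $i$; for $i\ne j$, agents $i,j$ are adjacent in $\mathcal{G}$ iff $w_{ij},w_{ji}>0$ (and $w_{ij}=w_{ji}=0$ otherwise). Algorithm: $x_{i,0}\in\mathbb{R}^p$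 arbitrary (deterministic), $y_{i,0}=g_i(x_{i,0},\xi_{i,0})$, and for $k\ge0$ $$x_{i,k+1}=\sum_{j=1}^nw_{ij}(x_{j,k}-\alpha_ky_{j,k}),\qquad y_{i,k+1}=\sum_{j=1}^nw_{ij}y_{j,k}+g_i(x_{i,k+1},\xi_{i,k+1})-g_i(x_{i,k},\xi_{i,k}).$$ Notation: $\mathbf{x}_k=[x_{1,k},\dots,x_{n,k}]^\top\in\mathbb{R}^{n\times p}$, $\overline{x}_k=\frac1n\mathbf{1}^\top\mathbf{x}_k$ (row vectors are identified with vectors in $\mathbb{R}^p$ when convenient), $\mathbf{1}$ the all-ones column vector, $\mathbf{I}$ the identity. $\|\cdot\|$ is the 2-norm for vectors and the Frobenius norm for matrices. $\rho_w$ is the spectral norm of $\mathbf{W}-\frac1n\mathbf{1}\mathbf{1}^\top$ (under (A3), (A4) one has $\rho_w<1$). If $\rho_w=0$, the second condition on $m$ is read after multiplying both sides by $\rho_w^2$, and the inverse $(\cdot)^{-1}$ in $C$ is read as $0$. *)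

(* Defs.v *)
From HB Require Import structures.
From mathcomp Require Import all_boot all_order all_algebra.
From mathcomp Require Import all_classical all_reals all_analysis.

Set Implicit Arguments.
Unset Strict Implicit.
Unset Printing Implicit Defensive.

Import Order.TTheory GRing.Theory Num.Theory.
Import numFieldNormedType.Exports.

Local Open Scope classical_set_scope.
Local Open Scope ring_scope.

(* The Borel sigma-algebra of R^n, presented as the product sigma-algebra:
   it is generated by the coordinates, as the library does for n.-tuple. *)
Definition rV_display : measure_display. Proof. exact: default_measure_display. Qed.

Section measurable_rV.
Context (R : realType) (n : nat).

Let coord (i : 'I_n) (v : 'rV[R]_n) : R := v 0 i.

Let rV_set0 : g_sigma_preimage coord set0.
Proof. exact: sigma_algebra0. Qed.

Let rV_setC A : g_sigma_preimage coord A -> g_sigma_preimage coord (~` A).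
Proof. exact: sigma_algebraC. Qed.

Let rV_bigcup (F : _^nat) : (forall i, g_sigma_preimage coord (F i)) ->
  g_sigma_preimage coord (\bigcup_i (F i)).
Proof. exact: sigma_algebra_bigcup. Qed.

HB.instance Definition _ := @isMeasurable.Build rV_display
  'rV[R]_n (g_sigma_preimage coord) rV_set0 rV_setC rV_bigcup.

End measurable_rV.

Section euclidean.
Context {R : realType}.

(* The Frobenius norm, i.e. the 2-norm on 'rV and 'cV; the library norm `|A|
   on matrices is the sup norm. *)
Definition norm2 {a b : nat} (A : 'M[R]_(a, b)) : R :=
  Num.sqrt (\sum_i \sum_j A i j ^+ 2).

Definition dotv {p : nat} (u v : 'rV[R]_p) : R := (u *m v^T) 0 0.

Definition spectral_norm {a b : nat} (A : 'M[R]_(a, b)) : R :=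
  sup [set norm2 (A *m v) | v in [set v : 'cV[R]_b | norm2 v <= 1]].

(* Only meaningful where f is differentiable. *)
Definition grad {p : nat} (f : 'rV[R]_p -> R) (x : 'rV[R]_p) : 'rV[R]_p :=
  \row_j 'D_(delta_mx 0 j) f x.

Definition strongly_convex {p : nat} (mu : R) (f : 'rV[R]_p -> R) : Prop :=
  forall x x', mu * norm2 (x - x') ^+ 2 <= dotv (grad f x - grad f x') (x - x').

Definition lipschitz_grad {p : nat} (L : R) (f : 'rV[R]_p -> R) : Prop :=
  forall x x', norm2 (grad f x - grad f x') <= L * norm2 (x - x').

Definition avg {n p : nat} (f : 'I_n -> 'rV[R]_p -> R) (x : 'rV[R]_p) : R :=
  n%:R^-1 * \sum_i f i x.

End euclidean.

Definition mutually_independent {d d' : measure_display} {T : measurableType d}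
    {V : measurableType d'} {R : realType} (P : probability T R) {I : eqType}
    (X : I -> T -> V) : Prop :=
  forall (s : seq I) (B : I -> set V), uniq s ->
    (forall i, measurable (B i)) ->
    P (\big[setI/setT]_(i <- s) (X i @^-1` B i)) =
    (\prod_(i <- s) P (X i @^-1` B i))%E.

Section network.
Context {R : realType} {n : nat}.

Definition undirected_connected (e : rel 'I_n) : Prop :=
  [/\ symmetric e, irreflexive e & forall i j, connect e i j].

Definition mixing_matrix (e : rel 'I_n) (W : 'M[R]_n) : Prop :=
  [/\ forall i j, 0 <= W i j,
      W *m const_mx 1 = const_mx 1 :> 'cV[R]_n,
      const_mx 1 *m W = const_mx 1 :> 'rV[R]_n,
      exists i, 0 < W i i &
      forall i j, i != j ->
        if e i j then 0 < W i j /\ 0 < W j i else W i j = 0 /\ W j i = 0].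

Definition rho_w (W : 'M[R]_n) : R :=
  spectral_norm (W - n%:R^-1 *: ((const_mx 1 : 'cV[R]_n) *m (const_mx 1 : 'rV[R]_n))).

Definition row_mean {p : nat} (x : 'M[R]_(n, p)) : 'rV[R]_p :=
  n%:R^-1 *: ((const_mx 1 : 'rV[R]_n) *m x).

End network.

Section dsgt.
Context {R : realType} {n p q : nat}.

(* Unbiased stochastic gradients with variance at most sigma^2.  The equality
   of the (extended real) expectation with a finite number includes
   integrability of each coordinate. *)
Definition stochastic_gradient {d : measure_display} {T : measurableType d}
    (P : probability T R) (f : 'I_n -> 'rV[R]_p -> R)
    (g : 'I_n -> 'rV[R]_p -> 'rV[R]_q -> 'rV[R]_p)
    (xi : 'I_n -> nat -> {RV P >-> 'rV[R]_q}) (sigma : R) : Prop :=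
  [/\ forall i, measurable_fun setT (fun z : 'rV[R]_p * 'rV[R]_q => g i z.1 z.2),
      mutually_independent P
        (fun ik : 'I_n * nat => xi ik.1 ik.2 : T -> 'rV[R]_q),
      forall i k x j,
        ('E_P[fun w => (g i x (xi i k w) 0 j)%R] = (grad (f i) x 0 j)%:E)%E &
      forall i k x,
        ('E_P[fun w => (norm2 (g i x (xi i k w) - grad (f i) x) ^+ 2)%R]
          <= (sigma ^+ 2)%:E)%E].

(* The pair (x_{.,k}, y_{.,k}) computed from the noise realization z. *)
Fixpoint dsgt (W : 'M[R]_n) (alpha : nat -> R)
    (g : 'I_n -> 'rV[R]_p -> 'rV[R]_q -> 'rV[R]_p)
    (x0 : 'I_n -> 'rV[R]_p) (z : 'I_n -> nat -> 'rV[R]_q) (k : nat) :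
    ('I_n -> 'rV[R]_p) * ('I_n -> 'rV[R]_p) :=
  match k with
  | 0%N => (x0, fun i => g i (x0 i) (z i 0%N))
  | k'.+1 =>
      let: (x, y) := dsgt W alpha g x0 z k' in
      let x' i := \sum_j W i j *: (x j - alpha k' *: y j) in
      (x', fun i => \sum_j W i j *: y j + g i (x' i) (z i k'.+1) - g i (x i) (z i k'))
  end.

Definition dsgt_x (W : 'M[R]_n) (alpha : nat -> R)
    (g : 'I_n -> 'rV[R]_p -> 'rV[R]_q -> 'rV[R]_p)
    (x0 : 'I_n -> 'rV[R]_p) (z : 'I_n -> nat -> 'rV[R]_q) (k : nat) :
    'M[R]_(n, p) :=
  \matrix_(i < n) (dsgt W alpha g x0 z k).1 i.

End dsgt.

Arguments stochastic_gradient {R n p q d T} P f g xi sigma.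

Section stepsize.
Context {R : realType} {n : nat}.

(* When rho_w W = 0 the inverse is read as 0; MathComp's convention 0^-1 = 0
   would only apply inside it. *)
Definition const_C (W : 'M[R]_n) (L theta m : R) : R :=
  let rho := rho_w W in
  ((if rho == 0 then 0
    else ((1 - rho ^+ 2) / (2 * rho ^+ 2)
          - 4 * theta * L / m - 2 * theta ^+ 2 * L ^+ 2 / m ^+ 2)^-1) + 2)
    * norm2 (W - 1%:M) ^+ 2 * L ^+ 2
  + 3 * theta * L ^+ 3 / m.

Definition stepsize_cond1 (W : 'M[R]_n) (mu L theta m : R) : Prop :=
  let rho := rho_w W in
  Num.max (theta / 2 * (mu + L))
    ((4 * theta * L * rho ^+ 2
      + 2 * theta * L * rho * Num.sqrt (1 + 3 * rho ^+ 2)) / (1 - rho ^+ 2))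
  < m.

(* For rho_w W = 0 both sides are multiplied by rho_w^2, with the factor
   rho_w^2 cancelled on the left. *)
Definition stepsize_cond2 (W : 'M[R]_n) (mu L theta m : R) : Prop :=
  let rho := rho_w W in
  let bracket := (1 - rho ^+ 2) / 2 - (2 * m + 1) / (m + 1) ^+ 2 in
  let rhs := (theta * mu - 1)^-1 * (mu^-1 + theta / m)
               * (4 * theta ^+ 2 * L ^+ 5 / m ^+ 3)
             + 2 * const_C W L theta m / m ^+ 2 in
  if rho == 0 then
    rho ^+ 2 * rhs
      < (1 - rho ^+ 2) ^+ 2 / (theta ^+ 2 * (1 + rho ^+ 2)) * bracket
  else
    rhs
      < (1 - rho ^+ 2) ^+ 2 / (theta ^+ 2 * (1 + rho ^+ 2) * rho ^+ 2) * bracket.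

End stepsize.

(* Main.v *)
Require Import Defs.
From HB Require Import structures.
From mathcomp Require Import all_boot all_order all_algebra.
From mathcomp Require Import all_classical all_reals all_analysis.
From mathcomp Require Import measurable_realfun ring lra.
Import Order.TTheory GRing.Theory Num.Theory.
Import numFieldNormedType.Exports.
Local Open Scope classical_set_scope.
Local Open Scope ring_scope.

Set Implicit Arguments.
Unset Strict Implicit.
Unset Printing Implicit Defensive.

Local Notation sqnorm A := (norm2 A ^+ 2).

(** Write t = m + k, and let U, V, Y be the second moments of the optimality gap
    of the average iterate and of the deviations of the iterates and of the
    trackers from their averages.  The mixing matrix contracts deviations by a
    factor r < 1, so up to constants V' <= r V + t^-2 Y and
    Y' <= r Y + 1 + V + t^-2 (Y + U), while averaging the tracking recursion
    gives U' <= (1 - theta mu / t) U + V / t + theta^2 sigma^2 / (n t^2), because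
    the fresh noise is uncorrelated with the past and across agents.

    For large t the box U <= B, t^2 V <= kappa B, Y <= B is invariant once B is
    large enough, whence V = O(t^-2); the remaining finitely many steps only
    affect constants.  The source of the U-recursion is then
    theta^2 sigma^2 / (n t^2) + O(t^-3), and 2 A / t + c / t^(theta mu) with
    A = theta^2 sigma^2 / (n (theta mu - 1)) is a supersolution for large t: the
    factor 2 absorbs the O(t^-3) term. *)

(** * Squared norms and deviations from the mean *)

(** The three moments feed each other in a circle: V needs Y, Y needs V and U, and U needs V. With V
    measured in units of t^-2, every link decays relative to the damping of its recursion except the
    one from Y to V, and kappa is there to pay for that one. The tracker is correlated with the
    noise of its own step. The bounds for V and Y are therefore proved for each realization and see
    only the size of the noise. Apart from evaluating the noise variance at a random point,
    independence enters only through U, where it removes the cross terms and gives the factor 1/n.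
    One sigma-algebra serves both purposes: that of all samples but the one of agent i at step k
    contains the past as well as the other agents' samples of the same step. *)

Section squared_norm.
Context {R : realType}.
Implicit Types a b c : nat.

Lemma sqnorm_ge0 a b (A : 'M[R]_(a, b)) : 0 <= sqnorm A.
Proof. exact: sqr_ge0. Qed.

Lemma sqnormE a b (A : 'M[R]_(a, b)) : sqnorm A = \sum_i \sum_j A i j ^+ 2.
Proof.
by rewrite sqr_sqrtr// sumr_ge0// => i _; rewrite sumr_ge0// => j _; exact: sqr_ge0.
Qed.

Lemma sqnorm_rV n (v : 'rV[R]_n) : sqnorm v = \sum_j v 0 j ^+ 2.
Proof. by rewrite sqnormE big_ord1. Qed.

Lemma sqnorm_rows a b (A : 'M[R]_(a, b)) : sqnorm A = \sum_i sqnorm (row i A).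
Proof.
rewrite sqnormE; apply: eq_bigr => i _; rewrite sqnorm_rV.
by apply: eq_bigr => j _; rewrite mxE.
Qed.

Lemma sqnorm_tr a b (A : 'M[R]_(a, b)) : sqnorm A^T = sqnorm A.
Proof.
rewrite !sqnormE exchange_big; apply: eq_bigr => i _.
by apply: eq_bigr => j _; rewrite mxE.
Qed.

Lemma sqnormZ a b (t : R) (A : 'M[R]_(a, b)) : sqnorm (t *: A) = t ^+ 2 * sqnorm A.
Proof.
rewrite !sqnormE mulr_sumr; apply: eq_bigr => i _; rewrite mulr_sumr.
by apply: eq_bigr => j _; rewrite mxE exprMn.
Qed.

Lemma sqnormN a b (A : 'M[R]_(a, b)) : sqnorm (- A) = sqnorm A.
Proof. by rewrite -scaleN1r sqnormZ sqrrN expr1n mul1r. Qed.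

(** Young's inequality: entry by entry the gap is a square divided by [s]. The weight stays free so
    that the factor on [A] can be taken close enough to 1 for a contraction to survive. *)
Lemma sqnormD_le a b (s : R) (A B : 'M[R]_(a, b)) : 0 < s ->
  sqnorm (A + B) <= (1 + s) * sqnorm A + (1 + s^-1) * sqnorm B.
Proof.
move=> s0; rewrite !sqnormE !mulr_sumr -big_split ler_sum//= => i _.
rewrite !mulr_sumr -big_split ler_sum//= => j _; rewrite mxE -subr_ge0.
have -> : (1 + s) * A i j ^+ 2 + (1 + s^-1) * B i j ^+ 2 - (A i j + B i j) ^+ 2
    = s^-1 * (s * A i j - B i j) ^+ 2 by field; rewrite gt_eqF.
by rewrite mulr_ge0 ?sqr_ge0// invr_ge0 ltW.
Qed.

Lemma sqnormD2 a b (A B : 'M[R]_(a, b)) :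
  sqnorm (A + B) <= 2 * sqnorm A + 2 * sqnorm B.
Proof. by have := sqnormD_le A B ltr01; rewrite invr1 -natr1. Qed.

Lemma sqnormD3 a b (A B C : 'M[R]_(a, b)) :
  sqnorm (A + B + C) <= 3 * sqnorm A + 3 * sqnorm B + 3 * sqnorm C.
Proof.
have := sqnormD_le (A + B) C (s := 2^-1) ltac:(by rewrite invr_gt0).
have := sqnormD2 A B; rewrite invrK; lra.
Qed.

(** Cauchy-Schwarz by Lagrange's identity: the sum of the squared 2 x 2 minors is twice the gap. *)
Lemma sqr_sum_mul_le (I : finType) (F G : I -> R) :
  (\sum_i F i * G i) ^+ 2 <= (\sum_i F i ^+ 2) * (\sum_i G i ^+ 2).
Proof.
have : 0 <= \sum_i \sum_j (F i * G j - F j * G i) ^+ 2.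
  by apply: sumr_ge0 => i _; apply: sumr_ge0 => j _; exact: sqr_ge0.
suff -> : \sum_i \sum_j (F i * G j - F j * G i) ^+ 2 =
    2 * ((\sum_i F i ^+ 2) * (\sum_i G i ^+ 2) - (\sum_i F i * G i) ^+ 2).
  by rewrite pmulr_rge0// subr_ge0.
have sumM (A B : I -> R) :
    \sum_i \sum_j A i * B j = (\sum_i A i) * (\sum_i B i).
  by rewrite mulr_suml; apply: eq_bigr => i _; rewrite mulr_sumr.
transitivity (\sum_i \sum_j F i ^+ 2 * G j ^+ 2 + \sum_i \sum_j G i ^+ 2 * F j ^+ 2
    + \sum_i \sum_j (- 2 * (F i * G i)) * (F j * G j)).
  rewrite -!big_split; apply: eq_bigr => i _; rewrite -!big_split.
  by apply: eq_bigr => j _ /=; ring.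
by rewrite !sumM -mulr_sumr; ring.
Qed.

Lemma sqnorm_mul a b c (A : 'M[R]_(a, b)) (B : 'M[R]_(b, c)) :
  sqnorm (A *m B) <= sqnorm A * sqnorm B.
Proof.
rewrite -(sqnorm_tr B) !sqnormE mulr_suml ler_sum// => i _.
rewrite mulr_sumr ler_sum// => j _; rewrite mxE.
rewrite [X in _ <= _ * X](_ : _ = \sum_k B k j ^+ 2); last first.
  by apply: eq_bigr => k _; rewrite mxE.
exact: sqr_sum_mul_le.
Qed.

End squared_norm.

Section centering.
Context {R : realType} {n p : nat}.
Implicit Types A B : 'M[R]_(n, p).

(** Kept convertible to the matrix in the final statement, so that rates for [deviation] apply there
    directly. *)
Definition deviation A : 'M[R]_(n, p) := A - (const_mx 1 : 'cV[R]_n) *m row_mean A.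

Lemma row_meanE A j : row_mean A 0 j = n%:R^-1 * \sum_i A i j.
Proof.
rewrite !mxE; congr (_ * _); apply: eq_bigr => i _.
by rewrite mxE mul1r.
Qed.

Lemma deviationE A i j : deviation A i j = A i j - row_mean A 0 j.
Proof.
by rewrite /deviation mxE [X in _ + X]mxE [X in - X]mxE big_ord1 mxE mul1r.
Qed.

Lemma row_meanD A B : row_mean (A + B) = row_mean A + row_mean B.
Proof. by rewrite /row_mean mulmxDr scalerDr. Qed.

Lemma row_meanZ t A : row_mean (t *: A) = t *: row_mean A.
Proof. by rewrite /row_mean -scalemxAr !scalerA mulrC. Qed.

Lemma row_meanN A : row_mean (- A) = - row_mean A.
Proof. by rewrite -scaleN1r row_meanZ scaleN1r. Qed.

Lemma deviationD A B : deviation (A + B) = deviation A + deviation B.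
Proof. by rewrite /deviation row_meanD mulmxDr opprD addrACA. Qed.

Lemma deviationZ t A : deviation (t *: A) = t *: deviation A.
Proof. by rewrite /deviation row_meanZ -scalemxAr scalerBr. Qed.

Lemma deviationN A : deviation (- A) = - deviation A.
Proof. by rewrite -scaleN1r deviationZ scaleN1r. Qed.

Hypothesis n0 : (0 < n)%N.

Let nR0 : n%:R != 0 :> R. Proof. by rewrite pnatr_eq0 -lt0n. Qed.

Lemma sum_deviation A j : \sum_i deviation A i j = 0.
Proof.
under eq_bigr do rewrite deviationE.
by rewrite sumrB sumr_const card_ord row_meanE -[X in _ - X]mulr_natl mulVKf// subrr.
Qed.

(** Pythagoras: the deviations of each column sum to zero, which kills the cross term. *)
Lemma sqnorm_deviation_mean A :
  sqnorm A = sqnorm (deviation A) + n%:R * sqnorm (row_mean A).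
Proof.
have colsE (B : 'M[R]_(n, p)) : sqnorm B = \sum_j \sum_i B i j ^+ 2.
  by rewrite sqnormE exchange_big.
rewrite sqnorm_rV !colsE mulr_sumr -big_split.
apply: eq_bigr => j _ /=.
transitivity (\sum_i (deviation A i j ^+ 2 + 2 * row_mean A 0 j * deviation A i j
    + row_mean A 0 j ^+ 2)).
  by apply: eq_bigr => i _; rewrite deviationE; ring.
rewrite !big_split /= -mulr_sumr sum_deviation mulr0 addr0.
by rewrite sumr_const card_ord -[X in _ + X]mulr_natl.
Qed.

Lemma sqnorm_deviation_le A : sqnorm (deviation A) <= sqnorm A.
Proof. by rewrite [leRHS]sqnorm_deviation_mean lerDl mulr_ge0 ?sqnorm_ge0. Qed.

Lemma sqnorm_mean_le A : sqnorm (row_mean A) <= n%:R^-1 * sqnorm A.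
Proof.
rewrite -[leLHS](mulKf nR0) ler_wpM2l ?invr_ge0 ?ler0n//.
by rewrite [leRHS]sqnorm_deviation_mean lerDr sqnorm_ge0.
Qed.

Lemma sqnorm_replicate (v : 'rV[R]_p) :
  sqnorm ((const_mx 1 : 'cV[R]_n) *m v) = n%:R * sqnorm v.
Proof.
rewrite sqnorm_rV sqnormE.
under eq_bigr => i _ do under eq_bigr => j _ do rewrite mxE big_ord1 mxE mul1r.
by rewrite sumr_const card_ord -[LHS]mulr_natl.
Qed.

End centering.

(** * Contraction by the mixing matrix *)

Section mixing.
Context {R : realType} {n : nat} (e : rel 'I_n) (W : 'M[R]_n).
Hypotheses (econn : undirected_connected e) (Wmix : mixing_matrix e W).

Let W_ge0 i j : 0 <= W i j. Proof. by case: Wmix. Qed.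

Let W_row i : \sum_j W i j = 1.
Proof.
have [_ /matrixP/(_ i 0) + _ _ _] := Wmix; rewrite !mxE => <-.
by apply: eq_bigr => j _; rewrite mxE mulr1.
Qed.

Let W_col j : \sum_i W i j = 1.
Proof.
have [_ _ /matrixP/(_ 0 j) + _ _] := Wmix; rewrite !mxE => <-.
by apply: eq_bigr => i _; rewrite mxE mul1r.
Qed.

Lemma mixing_size_gt0 : (0 < n)%N.
Proof. by have [_ _ _ [i _] _] := Wmix; exact: leq_ltn_trans (ltn_ord i). Qed.

Lemma row_mean_mix p (A : 'M[R]_(n, p)) : row_mean (W *m A) = row_mean A.
Proof. by have [_ _ W1 _ _] := Wmix; rewrite /row_mean mulmxA W1. Qed.

Lemma deviation_mix p (A : 'M[R]_(n, p)) : deviation (W *m A) = W *m deviation A.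
Proof.
have [_ W1 _ _ _] := Wmix.
by rewrite /deviation row_mean_mix mulmxBr mulmxA W1.
Qed.

Let mixed (u : 'rV[R]_n) i := \sum_j W i j * u 0 j.

(** Each row of [W] is a probability vector; [mixed u i] is the mean of [u] under it and the inner
    sum on the right its variance. Unit column sums make the second moments add up to that of
    [u]. *)
Let mixed_deficit (u : 'rV[R]_n) :
  \sum_j u 0 j ^+ 2 - \sum_i mixed u i ^+ 2 =
  \sum_i \sum_j W i j * (u 0 j - mixed u i) ^+ 2.
Proof.
transitivity (\sum_i (\sum_j W i j * u 0 j ^+ 2 - mixed u i ^+ 2)).
  rewrite sumrB exchange_big /=; congr (_ - _); apply: eq_bigr => j _.
  by rewrite -mulr_suml W_col mul1r.
apply: eq_bigr => i _.
transitivity (\sum_j (W i j * u 0 j ^+ 2 - 2 * mixed u i * (W i j * u 0 j)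
   + mixed u i ^+ 2 * W i j)).
  by rewrite big_split sumrB /= -!mulr_sumr W_row -/(mixed u i); ring.
by apply: eq_bigr => j _; ring.
Qed.

(* If W preserves the norm of u, then u is constant on the support of every row
   of W; crossing an edge swaps u and W u, and the positive diagonal entry makes
   them agree, so u is constant. *)
Let mixed_norm_lt (u : 'rV[R]_n) : \sum_j u 0 j = 0 -> \sum_j u 0 j ^+ 2 = 1 ->
  \sum_i mixed u i ^+ 2 < 1.
Proof.
move=> u0 u1; rewrite -u1 -subr_gt0 mixed_deficit.
have term_ge0 i j : 0 <= W i j * (u 0 j - mixed u i) ^+ 2.
  by rewrite mulr_ge0 ?sqr_ge0.
rewrite lt_neqAle sumr_ge0 ?andbT => [|i _]; last by rewrite sumr_ge0.
apply/eqP => /esym/eqP; rewrite psumr_eq0 => [/allP hz|i _]; last exact: sumr_ge0.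
have ueq i j : 0 < W i j -> u 0 j = mixed u i.
  move=> Wij; have := hz i; rewrite mem_index_enum => /(_ isT) /=.
  rewrite psumr_eq0// => /allP/(_ j); rewrite mem_index_enum => /(_ isT) /=.
  by rewrite mulf_eq0 gt_eqF//= sqrf_eq0 subr_eq0 => /eqP.
have [e_sym e_irr e_con] := econn.
have [_ _ _ [i0 Wi0] Wsupp] := Wmix.
pose a := [pred i | (u 0 i == u 0 i0) && (mixed u i == u 0 i0)].
have closed_a : closed_mem e (mem a).
  apply: intro_closed; first exact: sym_connect_sym.
  move=> i j eij; rewrite !inE => /andP[/eqP ui /eqP mi].
  have ij : i != j by apply: contraTneq eij => ->; rewrite e_irr.
  have := Wsupp i j ij; rewrite eij => -[Wij Wji].
  by rewrite (ueq i j)// mi eqxx /= -(ueq j i)// ui.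
have uc i : u 0 i = u 0 i0.
  have := closed_connect closed_a (e_con i0 i); rewrite !inE eqxx.
  by rewrite -(ueq _ _ Wi0) eqxx => /esym/andP[/eqP].
have u00 : u 0 i0 = 0.
  move: u0; under eq_bigr do rewrite uc.
  rewrite sumr_const card_ord => /eqP; rewrite mulrn_eq0 => /orP[|/eqP//].
  by rewrite eqn0Ngt mixing_size_gt0.
move: u1; rewrite big1 => [/esym/eqP|i _]; first by rewrite oner_eq0.
by rewrite uc u00 expr0n.
Qed.

(** Compactness turns the strict decrease into a uniform factor: on the unit sphere of the mean-zero
    vectors the squared norm after mixing attains its maximum, which is then below 1. *)
Lemma mixing_contraction : exists2 r : R, 0 <= r < 1 &
  forall p (A : 'M[R]_(n, p)), sqnorm (deviation (W *m A)) <= r * sqnorm (deviation A).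
Proof.
suff [r r01 hr] : exists2 r : R, 0 <= r < 1 & forall u : 'rV[R]_n,
    \sum_j u 0 j = 0 -> \sum_i mixed u i ^+ 2 <= r * \sum_j u 0 j ^+ 2.
  (* Every column of a deviation has mean zero, so the vector bound applies columnwise and one [r]
     serves all widths [p]. *)
  exists r => // p A; rewrite deviation_mix !sqnormE.
  rewrite exchange_big [in leRHS]exchange_big mulr_sumr ler_sum//= => k _.
  have colE j : (col k (deviation A))^T 0 j = deviation A j k.
    by rewrite mxE [LHS]mxE.
  have := hr (col k (deviation A))^T _.
  rewrite (eq_bigr _ (fun j _ => colE j)) (sum_deviation mixing_size_gt0) => /(_ erefl).
  rewrite [X in _ <= _ * X -> _](eq_bigr (fun j => deviation A j k ^+ 2)) => [|j _].
    congr (_ <= _); apply: eq_bigr => i _; rewrite [in RHS]mxE /mixed; congr (_ ^+ 2).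
    by apply: eq_bigr => j _; rewrite colE.
  by rewrite colE.
pose K := [set u : 'rV[R]_n | \sum_j u 0 j = 0 /\ \sum_j u 0 j ^+ 2 = 1].
have normalise r : 0 <= r -> (forall u, K u -> \sum_i mixed u i ^+ 2 <= r) ->
    forall u : 'rV[R]_n, \sum_j u 0 j = 0 ->
    \sum_i mixed u i ^+ 2 <= r * \sum_j u 0 j ^+ 2.
  move=> r0 Kr u u0; set s := \sum_j u 0 j ^+ 2.
  have s0 : 0 <= s by apply: sumr_ge0 => j _; exact: sqr_ge0.
  have [s00|sn0] := eqVneq s 0.
    have uz j : u 0 j = 0.
      move/eqP: s00; rewrite psumr_eq0 => [/allP/(_ j)|k _]; last exact: sqr_ge0.
      by rewrite mem_index_enum => /(_ isT); rewrite sqrf_eq0 => /eqP.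
    rewrite s00 mulr0 big1// => i _; rewrite /mixed big1 ?expr0n// => j _.
    by rewrite uz mulr0.
  have sp : 0 < s by rewrite lt_neqAle eq_sym sn0.
  have ks : (Num.sqrt s)^-1 ^+ 2 = s^-1 by rewrite exprVn sqr_sqrtr.
  have := Kr ((Num.sqrt s)^-1 *: u); rewrite -ler_pdivrMr// => hK.
  apply: le_trans (hK _); last first.
    split; under eq_bigr do rewrite mxE ?exprMn ?ks.
      by rewrite -mulr_sumr u0 mulr0.
    by rewrite -mulr_sumr mulVf.
  rewrite mulr_suml ler_sum// => i _; rewrite /mixed.
  under [in leRHS]eq_bigr do rewrite mxE mulrCA.
  by rewrite -mulr_sumr exprMn ks mulrC.
(* The sphere is empty when n = 1; deviations then vanish and the factor 0 works. *)
have [[u0 Ku0]|K0] := pselect (K !=set0); last first.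
  exists 0; rewrite ?lexx ?ltr01//; apply: normalise => // u Ku.
  by exfalso; apply: K0; exists u.
have coordc j : continuous (fun u : 'rV[R]_n => u 0 j) by exact: coord_continuous.
have sumc (F : 'I_n -> 'rV[R]_n -> R) : (forall j, continuous (F j)) ->
    continuous (fun u => \sum_j F j u).
  move=> cF; elim: (index_enum _) => [|j l IH] u.
    rewrite (_ : (fun v => _) = cst 0); last by apply/funext => v; rewrite big_nil.
    exact: cst_continuous.
  rewrite (_ : (fun v => _) = F j \+ (fun v => \sum_(i <- l) F i v)); last first.
    by apply/funext => v; rewrite big_cons.
  by apply: continuousD; [exact: cF|exact: IH].
have sqrc (F : 'rV[R]_n -> R) : continuous F -> continuous (fun u => F u ^+ 2).
  by move=> cF u; exact: (continuous_comp (cF u) (@exprn_continuous _ _ _)).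
have mixedc i : continuous (mixed^~ i).
  by apply: sumc => j u; apply: continuousM; [exact: cst_continuous|exact: coordc].
have [|||c cK cmax] := @EVT_max_rV R n (fun u => \sum_i mixed u i ^+ 2) K.
- by exists u0.
(* The ambient norm is the sup norm; a unit 2-norm bounds each coordinate by 1. *)
- apply: bounded_closed_compact.
    exists 1; split => // M M1 u [_ u1] /=; rewrite [leLHS]/Num.Def.normr /= mx_normrE.
    apply: bigmax_le => [|[i j] _ /=]; first by rewrite (le_trans ler01)// ltW.
    rewrite (ord1 i) (le_trans _ (ltW M1))// -(@ler_pXn2r _ 2)// ?nnegrE//.
    rewrite expr1n real_normK ?num_real// -u1 (bigD1 j)//= lerDl sumr_ge0// => k _.
    exact: sqr_ge0.
  apply: closedI.
    apply: (@preimage_closed _ _ (fun u : 'rV[R]_n => \sum_j u 0 j)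
      [set x | x = 0]) => [u _|]; [exact: sumc|exact: closed_eq].
  apply: (@preimage_closed _ _ (fun u : 'rV[R]_n => \sum_j u 0 j ^+ 2)
    [set x | x = 1]) => [u _|]; last exact: closed_eq.
  by apply: sumc => j; exact: sqrc.
- by apply: continuous_subspaceT; apply: sumc => i; exact: sqrc.
have {}cK : K c by exact: set_mem.
have r0 : 0 <= \sum_i mixed c i ^+ 2 by apply: sumr_ge0 => i _; exact: sqr_ge0.
exists (\sum_i mixed c i ^+ 2).
  by rewrite r0 mixed_norm_lt//; case: cK.
by apply: normalise => // u Ku; apply: cmax; exact: mem_set.
Qed.
End mixing.

(** * Gradients and one step of the algorithm *)

Section gradients.
Context {R : realType} {n p : nat} (f : 'I_n -> 'rV[R]_p -> R).

(** Fermat's rule on each coordinate line through [xstar]: [phi] is a function of one variable with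
    an interior minimum at 0. *)
Lemma stationary (xstar : 'rV[R]_p) : (0 < n)%N ->
  (forall i x, differentiable (f i) x) ->
  (forall x, avg f xstar <= avg f x) -> \sum_i grad (f i) xstar = 0.
Proof.
move=> n0 df hmin; apply/rowP => j; rewrite summxE [RHS]mxE.
under eq_bigr do rewrite mxE; set v := delta_mx 0 j.
have dsum x : derivable (\sum_i f i) x v.
  by apply: derivable_sum => i; exact: diff_derivable.
have -> : \sum_i 'D_v (f i) xstar = 'D_v (\sum_i f i) xstar.
  by rewrite derive_sum// => i; exact: diff_derivable.
pose phi (t : R) := (\sum_i f i) (t *: v + xstar).
have quotE (t : R) :
    (fun h => h^-1 *: ((phi \o shift t) (h *: 1) - phi t)) =
    (fun h => h^-1 *: (((\sum_i f i) \o shift (t *: v + xstar)) (h *: v)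
      - (\sum_i f i) (t *: v + xstar))).
  apply/funext => h; rewrite /phi /= scalerDl addrA.
  by rewrite [in X in X *: v]/GRing.scale /= mulr1.
have dphi t : derivable phi t 1 by rewrite /derivable quotE; exact: dsum.
have [||||_ D0] := @derive1_at_min R phi (-1) 1 0.
- by lra.
- by move=> t _.
- by rewrite in_itv /= ltrN10 ltr01.
- move=> t _; rewrite /phi scale0r add0r.
  have := hmin (t *: v + xstar); rewrite /avg !fct_sumE.
  by rewrite ler_pM2l// invr_gt0 ltr0n.
by move: D0; rewrite /derive quotE scale0r add0r.
Qed.

(** The gradient of the average cost at v is represented as [row_mean (grads (replicate v))], so
    that Lipschitz bounds for stacked gradients apply to it. *)
Definition grads (x : 'M[R]_(n, p)) : 'M[R]_(n, p) :=
  \matrix_i grad (f i) (row i x).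

Definition replicate (v : 'rV[R]_p) : 'M[R]_(n, p) := (const_mx 1 : 'cV[R]_n) *m v.

Lemma row_replicate i v : row i (replicate v) = v.
Proof. by apply/rowP => j; rewrite !mxE big_ord1 mxE mul1r. Qed.

Lemma replicateB u v : replicate (u - v) = replicate u - replicate v.
Proof. exact: mulmxBr. Qed.

Lemma deviation_def (x : 'M[R]_(n, p)) : deviation x = x - replicate (row_mean x).
Proof. by []. Qed.

Context (mu L : R).
Hypotheses (fconvex : forall i, strongly_convex mu (f i))
  (fsmooth : forall i, lipschitz_grad L (f i)) (L0 : 0 < L) (n0 : (0 < n)%N).

Let nR0 : n%:R != 0 :> R. Proof. by rewrite pnatr_eq0 -lt0n. Qed.

Lemma row_mean_replicate v : row_mean (replicate v) = v.
Proof.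
apply/rowP => j; rewrite row_meanE.
under eq_bigr do rewrite mxE big_ord1 mxE mul1r.
by rewrite sumr_const card_ord -[X in _ * X]mulr_natl mulKf.
Qed.

Lemma grads_lipschitz x x' : sqnorm (grads x - grads x') <= L ^+ 2 * sqnorm (x - x').
Proof.
rewrite 2!sqnorm_rows mulr_sumr ler_sum// => i _.
rewrite !linearB /= !rowK -exprMn ler_pXn2r ?nnegrE ?mulr_ge0 ?sqrtr_ge0 ?(ltW L0)//.
exact: fsmooth.
Qed.

Lemma dotvE (u v : 'rV[R]_p) : dotv u v = \sum_j u 0 j * v 0 j.
Proof. by rewrite /dotv mxE; apply: eq_bigr => j _; rewrite mxE. Qed.

Lemma sqnorm_sub_scale t (u v : 'rV[R]_p) :
  sqnorm (u - t *: v) = sqnorm u - 2 * t * dotv v u + t ^+ 2 * sqnorm v.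
Proof.
rewrite !sqnorm_rV dotvE !mulr_sumr -sumrB -big_split.
by apply: eq_bigr => j _; rewrite !mxE /=; ring.
Qed.

Lemma mean_grad_monotone u v :
  mu * sqnorm (u - v) <=
  dotv (row_mean (grads (replicate u)) - row_mean (grads (replicate v))) (u - v).
Proof.
have -> : dotv (row_mean (grads (replicate u)) - row_mean (grads (replicate v))) (u - v)
   = n%:R^-1 * \sum_i dotv (grad (f i) u - grad (f i) v) (u - v).
  under eq_bigr do rewrite dotvE.
  rewrite dotvE exchange_big mulr_sumr; apply: eq_bigr => j _.
  rewrite -mulr_suml mulrA; congr (_ * _).
  rewrite [LHS]mxE [X in _ + X]mxE !row_meanE -mulrBr -sumrB; congr (_ * _).
  by apply: eq_bigr => i _; rewrite !mxE !row_replicate.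
rewrite -[leLHS](mulKf nR0) ler_wpM2l ?invr_ge0 ?ler0n//.
have -> : n%:R * (mu * sqnorm (u - v)) = \sum_(i < n) mu * sqnorm (u - v).
  by rewrite sumr_const card_ord mulr_natl.
by apply: ler_sum => i _; exact: fconvex.
Qed.

(** In the expanded square, strong convexity controls the inner product and the Lipschitz bound the
    quadratic term. The factor is simplified only once the step is known to be small. *)
Lemma gradient_step_contraction t u v : 0 <= t ->
  sqnorm (u - v - t *: (row_mean (grads (replicate u)) - row_mean (grads (replicate v))))
    <= (1 - 2 * t * mu + t ^+ 2 * L ^+ 2) * sqnorm (u - v).
Proof.
move=> t0; rewrite sqnorm_sub_scale.
set G := row_mean _ - row_mean _.
have GL : sqnorm G <= L ^+ 2 * sqnorm (u - v).
  rewrite /G -row_meanN -row_meanD (le_trans (sqnorm_mean_le n0 _))//.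
  rewrite ler_pdivrMl ?ltr0n// (le_trans (grads_lipschitz _ _))// -replicateB.
  by rewrite sqnorm_replicate; lra.
have := mean_grad_monotone u v; rewrite -/G => Gm.
have : t * (mu * sqnorm (u - v)) <= t * dotv G (u - v) by rewrite ler_wpM2l.
have : t ^+ 2 * sqnorm G <= t ^+ 2 * (L ^+ 2 * sqnorm (u - v)).
  by rewrite ler_wpM2l ?sqr_ge0.
lra.
Qed.

Lemma mean_grad_deviation x :
  sqnorm (row_mean (grads x) - row_mean (grads (replicate (row_mean x))))
    <= n%:R^-1 * L ^+ 2 * sqnorm (deviation x).
Proof.
rewrite -row_meanN -row_meanD (le_trans (sqnorm_mean_le n0 _))// -mulrA.
by rewrite ler_wpM2l ?invr_ge0 ?ler0n// deviation_def grads_lipschitz.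
Qed.

Context (xstar : 'rV[R]_p).
Hypothesis (gstar : row_mean (grads (replicate xstar)) = 0).

(** The averaged gradient is split into the exact gradient at the mean, which contracts towards
    [xstar], and the error caused by disagreement. The Young weight [s] will be proportional to the
    stepsize. *)
Lemma mean_step_bound s t x : 0 < s -> 0 <= t ->
  sqnorm (row_mean x - xstar - t *: row_mean (grads x)) <=
  (1 + s) * (1 - 2 * t * mu + t ^+ 2 * L ^+ 2) * sqnorm (row_mean x - xstar)
  + (1 + s^-1) * (t ^+ 2 * (n%:R^-1 * L ^+ 2 * sqnorm (deviation x))).
Proof.
move=> s0 t0; set xb := row_mean x.
have -> : xb - xstar - t *: row_mean (grads x) =
  (xb - xstar - t *: (row_mean (grads (replicate xb)) - row_mean (grads (replicate xstar))))
  + (- t) *: (row_mean (grads x) - row_mean (grads (replicate xb))).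
  rewrite gstar subr0 scaleNr scalerBr; set a := t *: _; set b := t *: _.
  by rewrite opprB addrA subrK.
apply: le_trans (sqnormD_le _ _ s0) _; rewrite lerD//.
  rewrite -mulrA ler_wpM2l ?gradient_step_contraction//.
  by rewrite addr_ge0// ltW.
rewrite ler_wpM2l ?addr_ge0 ?invr_ge0 ?(ltW s0)// sqnormZ sqrrN.
by rewrite ler_wpM2l ?sqr_ge0// mean_grad_deviation.
Qed.

Lemma sqnorm_from_optimum x :
  sqnorm (x - replicate xstar) =
  sqnorm (deviation x) + n%:R * sqnorm (row_mean x - xstar).
Proof.
rewrite (sqnorm_deviation_mean n0) row_meanD row_meanN row_mean_replicate.
congr (sqnorm _ + _); rewrite deviationD deviationN.
by rewrite [X in _ - X]deviation_def row_mean_replicate subrr subr0.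
Qed.

End gradients.

Section one_step.
Context {R : realType} {n p : nat} (f : 'I_n -> 'rV[R]_p -> R) (mu L : R).
Context (e : rel 'I_n) (W : 'M[R]_n) (xstar : 'rV[R]_p).
Hypotheses (econn : undirected_connected e) (Wmix : mixing_matrix e W).
Hypotheses (fsmooth : forall i, lipschitz_grad L (f i)) (L0 : 0 < L).
Hypothesis (gstar : row_mean (grads f (replicate xstar)) = 0).

Let n0 : (0 < n)%N := mixing_size_gt0 Wmix.

(** The mean gradient vanishes at [xstar], so the stacked gradients there can be subtracted without
    changing the mean of [y]; noise and a Lipschitz term remain. *)
Lemma sqnorm_tracker (x y nu : 'M[R]_(n, p)) :
  row_mean y = row_mean (nu + grads f x) ->
  sqnorm y <= sqnorm (deviation y) + 2 * sqnorm nu + 2 * L ^+ 2 *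
    (sqnorm (deviation x) + n%:R * sqnorm (row_mean x - xstar)).
Proof.
move=> hy; rewrite (sqnorm_deviation_mean n0) -!addrA lerD2l.
rewrite -(sqnorm_from_optimum n0).
have -> : row_mean y = row_mean (nu + (grads f x - grads f (replicate xstar))).
  by rewrite hy addrA [in RHS]row_meanD row_meanN gstar subr0.
apply: (@le_trans _ _ (sqnorm (nu + (grads f x - grads f (replicate xstar))))).
  by rewrite -ler_pdivlMl ?ltr0n// sqnorm_mean_le.
have := sqnormD2 nu (grads f x - grads f (replicate xstar)).
have := grads_lipschitz fsmooth L0 x (replicate xstar).
lra.
Qed.

(** [nu] and [nu'] are arbitrary matrices here, so the result applies to each realization whatever
    the correlations. *)
Lemma consensus_step_bounds (abar : R) : exists r C : R, [/\ 0 <= r < 1, 0 < C &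
  forall (a : R) (x y nu nu' : 'M[R]_(n, p)), 0 <= a <= abar ->
  row_mean y = row_mean (nu + grads f x) ->
  let x' := W *m (x - a *: y) in
  let y' := W *m y + (nu' + grads f x') - (nu + grads f x) in
  sqnorm (deviation x') <= r * sqnorm (deviation x)
     + C * (a ^+ 2 * sqnorm (deviation y)) /\
  sqnorm (deviation y') <= r * sqnorm (deviation y)
     + C * (sqnorm nu + sqnorm nu' + sqnorm (deviation x)
       + a ^+ 2 * sqnorm (deviation y) + a ^+ 2 * sqnorm (row_mean x - xstar))].
Proof.
have [r0 r01 hr] := mixing_contraction econn Wmix.
(* With this weight the inflated factor [(1 + s) * r0] stays below the midpoint [r] of r0 and 1, the
   difference being half of (1 - r0)^2. *)
pose s := (1 - r0) / 2; have s0 : 0 < s by rewrite /s; lra.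
pose r := (1 + r0) / 2.
have sr : (1 + s) * r0 <= r by rewrite /s /r; nra.
have si0 : 0 < s^-1 by rewrite invr_gt0.
pose N := sqnorm (W - 1%:M); pose M := sqnorm W.
have N0 : 0 <= N by exact: sqnorm_ge0.
have M0 : 0 <= M by exact: sqnorm_ge0.
have L20 : 0 < L ^+ 2 by rewrite exprn_gt0.
have nR : 0 <= n%:R :> R by [].
(* In front of the noise and of the deviation of [x] the squared stepsize is bounded by [b]; in
   front of the other two terms it is kept, because the rates need its decay. *)
pose b := abar ^+ 2; have b0 : 0 <= b by exact: sqr_ge0.
pose c1 := 6 * L ^+ 2 * N; pose c2 := 6 * L ^+ 2 * M.
have c10 : 0 <= c1 by rewrite /c1 !mulr_ge0 ?(ltW L0) ?sqrtr_ge0//.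
have c20 : 0 <= c2 by rewrite /c2 !mulr_ge0 ?(ltW L0) ?sqrtr_ge0//.
(* The sum of the coefficients in [t2] to [t5] below, hence above each of them; its 3 also covers
   [t1]. *)
pose C0 := 3 + 2 * c2 * b + c1 + 2 * c2 * L ^+ 2 * b + c2 + 2 * c2 * L ^+ 2 * n%:R.
have c2b0 : 0 <= 2 * c2 * b := mulr_ge0 (mulr_ge0 (ler0n R 2) c20) b0.
have c2L0 := mulr_ge0 (mulr_ge0 (ler0n R 2) c20) (ltW L20).
have c2Lb0 := mulr_ge0 c2L0 b0.
have c2Ln0 := mulr_ge0 c2L0 nR.
have C03 : 3 <= C0 by rewrite /C0; lra.
pose C := (1 + s^-1) * C0.
have C0C : C0 <= C by rewrite /C mulrDl mul1r lerDl mulr_ge0 ?ltW// (lt_le_trans _ C03).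
exists r, C; split; [by rewrite /r; lra|by lra|].
move=> a x y nu nu' /andP[a0 ab] hy /=.
have a2b : a ^+ 2 <= b by rewrite /b ler_pXn2r ?nnegrE// ?(le_trans a0 ab).
have dx0 := sqnorm_ge0 (deviation x); have dy0 := sqnorm_ge0 (deviation y).
split.
  apply: le_trans (hr _ _) _; rewrite deviationD deviationN deviationZ.
  have := sqnormD_le (deviation x) (- (a *: deviation y)) s0.
  rewrite sqnormN sqnormZ => h; set z := a ^+ 2 * _ in h *.
  have z0 : 0 <= z by rewrite mulr_ge0 ?sqr_ge0.
  have h1 : r0 * sqnorm (deviation x - a *: deviation y) <=
    r0 * ((1 + s) * sqnorm (deviation x) + (1 + s^-1) * z) by rewrite ler_wpM2l//; lra.
  have h2 : (1 + s) * r0 * sqnorm (deviation x) <= r * sqnorm (deviation x).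
    by rewrite ler_wpM2r.
  have h3 : r0 * ((1 + s^-1) * z) <= C * z.
    rewrite mulrA ler_wpM2r// /C mulrC ler_wpM2l; lra.
  lra.
set x' := W *m (x - a *: y).
(* Since [W] fixes constant columns, [W - 1] annihilates the mean: the displacement sees only the
   disagreement and the step. *)
have dxx : x' - x = (W - 1%:M) *m deviation x - a *: (W *m y).
  rewrite /x' mulmxBr -scalemxAr addrAC; congr (_ - _).
  have [_ W1 _ _ _] := Wmix.
  rewrite mulmxBl mul1mx deviation_def mulmxBr /replicate mulmxA W1.
  by rewrite opprB addrA subrK.
have hx' : sqnorm (x' - x) <= 2 * N * sqnorm (deviation x) + 2 * (a ^+ 2 * (M * sqnorm y)).
  rewrite dxx (le_trans (sqnormD2 _ _))// sqnormN sqnormZ -mulrA lerD//.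
    by rewrite ler_wpM2l// sqnorm_mul.
  by rewrite ler_wpM2l// ler_wpM2l ?sqr_ge0// sqnorm_mul.
have hyb := sqnorm_tracker hy.
pose D := nu' - nu + (grads f x' - grads f x).
have -> : W *m y + (nu' + grads f x') - (nu + grads f x) = W *m y + D.
  by rewrite /D opprD !addrA; congr (_ + _); rewrite addrAC.
have hD : sqnorm D <= 3 * sqnorm nu' + 3 * sqnorm nu + 3 * L ^+ 2 * sqnorm (x' - x).
  have := sqnormD3 nu' (- nu) (grads f x' - grads f x); rewrite sqnormN -/D.
  have := grads_lipschitz fsmooth L0 x' x; lra.
rewrite deviationD.
apply: le_trans (sqnormD_le _ _ s0) _.
have h1 : (1 + s) * sqnorm (deviation (W *m y)) <= r * sqnorm (deviation y).
  have := hr _ y; rewrite -(ler_pM2l (x := 1 + s)); last by lra.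
  move=> /le_trans; apply; rewrite mulrA ler_wpM2r//.
set S := _ + sqnorm nu' + _ + _ + _.
have a20 : 0 <= a ^+ 2 by exact: sqr_ge0.
have U0 := sqnorm_ge0 (row_mean x - xstar).
have nu0 := sqnorm_ge0 nu; have nu'0 := sqnorm_ge0 nu'.
have h2 : sqnorm D <= C0 * S.
  have k1 := ler_wpM2l (ltW L20) hx'.
  have k2 := ler_wpM2l (mulr_ge0 c20 a20) hyb.
  have k3 := ler_wpM2l c20 (ler_wpM2r nu0 a2b).
  have k4 := ler_wpM2l (mulr_ge0 c20 (ltW L20)) (ler_wpM2r dx0 a2b).
  have term c z : c <= C0 -> 0 <= z -> c * z <= C0 * z by move=> *; exact: ler_wpM2r.
  have t1 : 3 * sqnorm nu' <= C0 * sqnorm nu' by exact: term.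
  have t2 : (3 + 2 * c2 * b) * sqnorm nu <= C0 * sqnorm nu.
    by apply: term => //; rewrite /C0; lra.
  have t3 : (c1 + 2 * c2 * L ^+ 2 * b) * sqnorm (deviation x) <= C0 * sqnorm (deviation x).
    by apply: term => //; rewrite /C0; lra.
  have t4 : c2 * (a ^+ 2 * sqnorm (deviation y)) <= C0 * (a ^+ 2 * sqnorm (deviation y)).
    by apply: term; [rewrite /C0; lra|exact: mulr_ge0].
  have t5 : 2 * c2 * L ^+ 2 * n%:R * (a ^+ 2 * sqnorm (row_mean x - xstar)) <=
      C0 * (a ^+ 2 * sqnorm (row_mean x - xstar)).
    by apply: term; [rewrite /C0; lra|exact: mulr_ge0].
  rewrite /S !mulrDr; move: hD k1 k2 k3 k4 t1 t2 t3 t4 t5.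
  rewrite /c1 /c2; lra.
have h3 : (1 + s^-1) * sqnorm (deviation D) <= C * S.
  rewrite /C -mulrA ler_wpM2l ?addr_ge0 ?(ltW si0)//.
  exact: le_trans (sqnorm_deviation_le n0 _) h2.
lra.
Qed.

End one_step.

(** * Recursive inequalities *)

Section rates.
Context {R : realType}.

Lemma archimedean_bound (m x : R) : exists K : nat,
  forall k, (K <= k)%N -> 0 <= m -> x <= m + k%:R.
Proof.
exists (Num.bound `|x|) => k Kk m0.
apply: (@le_trans _ _ k%:R); last by rewrite lerDr.
apply: le_trans (ler_norm x) _; apply: ltW.
by apply: lt_le_trans (archi_boundP (normr_ge0 x)) _; rewrite ler_nat.
Qed.

(** The ratios [u k / v k] of the first [K] terms are added to the constant. *)
Lemma eventually_bounded (u v : nat -> R) K c : (forall k, 0 <= u k) ->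
  (forall k, 0 < v k) -> 0 <= c ->
  (forall k, (K <= k)%N -> u k <= c * v k) ->
  exists2 c', 0 <= c' & forall k, u k <= c' * v k.
Proof.
move=> u0 v0 c0 huv; pose S := \sum_(k < K) u k / v k.
have S0 : 0 <= S by apply: sumr_ge0 => k _; rewrite divr_ge0// ltW.
exists (c + S) => [|k]; first exact: addr_ge0.
have [Kk|kK] := leqP K k.
  by apply: le_trans (huv k Kk) _; rewrite ler_wpM2r ?lerDl// ltW.
rewrite -ler_pdivrMr// /S (bigD1 (Ordinal kK))//= addrCA lerDl addr_ge0//.
by apply: sumr_ge0 => i _; rewrite divr_ge0// ltW.
Qed.

(** Makes t^-a a supersolution of the homogeneous recursion with factor 1 - a/t. The exponential
    exp(-a/t) separates the two sides after division by t^-a. *)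
Lemma powR_inv_step (a t : R) : 0 <= a -> a <= t -> 0 < t ->
  (1 - a / t) * (t `^ a)^-1 <= ((t + 1) `^ a)^-1.
Proof.
move=> a0 at_ t0.
have ti0 : 0 < t^-1 by rewrite invr_gt0.
have -> : t + 1 = t * (1 + t^-1) by rewrite mulrDr mulr1 mulfV// gt_eqF.
rewrite powRM ?(ltW t0) ?addr_ge0 ?(ltW ti0)// invfM [leLHS]mulrC.
rewrite ler_wpM2l ?invr_ge0 ?powR_ge0//.
have le1 : (1 + t^-1) `^ a <= expR (a / t).
  rewrite /powR gt_eqF ?addr_gt0// ler_expR ler_wpM2l// le_ln1Dx//.
  by rewrite (lt_trans _ ti0)// ltrN10.
have : expR (- (a / t)) <= ((1 + t^-1) `^ a)^-1.
  by rewrite expRN lef_pV2 ?posrE ?expR_gt0 ?powR_gt0 ?addr_gt0.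
apply: le_trans; exact: expR_ge1Dx.
Qed.

Context (U V Y : nat -> R) (m theta mu r C Cu s2 b a0 : R).
Hypotheses (U0 : forall k, 0 <= U k) (V0 : forall k, 0 <= V k)
  (Y0 : forall k, 0 <= Y k).
Hypotheses (m0 : 0 < m) (theta0 : 0 < theta) (mu0 : 0 < mu) (r01 : 0 <= r < 1)
  (C0 : 0 <= C) (Cu0 : 0 <= Cu) (s20 : 0 <= s2) (b0 : 0 < b) (a00 : 0 < a0).

Let t (k : nat) := m + k%:R.
Let alpha k := theta / t k.

Hypothesis HV : forall k, V k.+1 <= r * V k + C * (alpha k ^+ 2 * Y k).
Hypothesis HY : forall k, Y k.+1 <=
  r * Y k + C * (s2 + V k + alpha k ^+ 2 * Y k + alpha k ^+ 2 * U k).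
Hypothesis HU : forall k, alpha k <= a0 -> U k.+1 <=
  (1 - alpha k * mu) * U k + Cu * (alpha k * V k) + alpha k ^+ 2 * b.

Let t0 k : 0 < t k. Proof. by rewrite /t ltr_wpDr. Qed.
Let tS k : t k.+1 = t k + 1. Proof. by rewrite /t -natr1 addrA. Qed.

Lemma consensus_rate : exists2 c, 0 <= c & forall k, V k <= c / t k ^+ 2.
Proof.
have [r0 r1] := andP r01; have thp := theta0; have mup := mu0.
have Cp := C0; have Cup := Cu0; have s2p := s20; have bp := b0.
(* Room for the growth of t^2 in one step: [r * (1 + 1/t)^2] stays below [r'] for large t. *)
pose r' := (1 + r) / 2.
(* Chosen so that the forcing of V by Y, at most [4 * C * theta ^+ 2 * B] after scaling, fits into
   the gap [kap * (1 - r') * B]. The summand 1 gives [B <= kap * B], needed at the start of the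
   induction. *)
pose kap := 4 * C * theta ^+ 2 / (1 - r') + 1.
have r'1 : 0 < 1 - r' by rewrite /r'; lra.
have kap1 : 1 <= kap.
  by rewrite lerDr divr_ge0 ?(ltW r'1)// mulr_ge0 ?sqr_ge0// mulr_ge0.
have kap0 : 0 <= kap by rewrite (le_trans ler01).
have kapE : 4 * C * theta ^+ 2 = (kap - 1) * (1 - r').
  by rewrite /kap addrK divfK// gt_eqF.
(* Beyond [T1] the factor for V is at most [r']; beyond [T2] the feedback of all three moments into
   Y costs at most half of [(1 - r) * B]; beyond [T3] the feedback of V into U costs at most half of
   the damping. *)
pose T1 := 6 / (1 - r). pose T2 := 2 * C * (kap + 2 * theta ^+ 2) / (1 - r).
pose T3 := 2 * Cu * kap / mu.
have [K hK] := archimedean_bound m (1 + theta + theta * mu + theta / a0 + T1 + T2 + T3).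
have T10 : 0 <= T1 by rewrite divr_ge0// subr_ge0 ltW.
have T20 : 0 <= T2.
  by rewrite divr_ge0 ?subr_ge0 ?(ltW r1)// !mulr_ge0// addr_ge0// mulr_ge0// sqr_ge0.
have T30 : 0 <= T3 by rewrite divr_ge0 ?(ltW mu0)// !mulr_ge0.
have th1 : 0 <= theta * mu by rewrite mulr_ge0 ?ltW.
have th2 : 0 <= theta / a0 by rewrite divr_ge0 ?ltW.
have {}hK k : (K <= k)%N -> [/\ 1 <= t k, theta <= t k, theta * mu <= t k,
    theta / a0 <= t k & T1 + T2 + T3 <= t k].
  move=> Kk; have := hK k Kk (ltW m0); rewrite -/(t k).
  move: (t k) (theta * mu) (theta / a0) (T1) (T2) (T3) th1 th2 T10 T20 T30.
  by move=> *; split; lra.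
have T3' k : (K <= k)%N -> T1 <= t k /\ T2 <= t k /\ T3 <= t k.
  move=> /hK[_ _ _ _]; move: (T1) (T2) (T3) T10 T20 T30 => x1 x2 x3 *.
  by split; [|split]; lra.
(* The first three summands put step [K] into the box; the last two let each constant noise source
   use at most half of the damping of its recursion. *)
pose B := U K + V K * t K ^+ 2 + Y K + 2 * b / mu + 2 * C * s2 / (1 - r).
have Bb : 0 <= 2 * b / mu by rewrite divr_ge0 ?(ltW mu0)// mulr_ge0// ltW.
have Bs : 0 <= 2 * C * s2 / (1 - r) by rewrite divr_ge0 ?subr_ge0 ?(ltW r1)// !mulr_ge0.
have BV : 0 <= V K * t K ^+ 2 by rewrite mulr_ge0// sqr_ge0.
have B0 : 0 <= B by rewrite /B !addr_ge0.
have Br : 2 * b <= mu * B.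
  have -> : 2 * b = mu * (2 * b / mu) by rewrite [RHS]mulrC divfK// gt_eqF.
  rewrite ler_wpM2l ?(ltW mup)// /B; have := U0 K; have := Y0 K; lra.
have Bs2 : 2 * (C * s2) <= (1 - r) * B.
  have -> : 2 * (C * s2) = (1 - r) * (2 * C * s2 / (1 - r)).
    by rewrite [RHS]mulrC divfK ?mulrA// subr_eq0 eq_sym lt_eqF.
  rewrite ler_wpM2l ?subr_ge0 ?(ltW r1)// /B; have := U0 K; have := Y0 K; lra.
have kapB : B <= kap * B by rewrite ler_peMl.
have inv j : let k := (K + j)%N in
    [/\ U k <= B, V k * t k ^+ 2 <= kap * B & Y k <= B].
  elim: j => [|j].
    rewrite addn0 /=; have u0 := U0 K; have y0 := Y0 K.
    by split; [|apply: le_trans _ kapB|]; rewrite /B; lra.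
  rewrite addnS; set k := (K + j)%N; move=> /= [UB VB YB].
  have Kk : (K <= k)%N by exact: leq_addr.
  have [t1 tth tthm ta0 _] := hK k Kk; have [tT1 [tT2 tT3]] := T3' k Kk.
  set x := (t k)^-1.
  have x0 : 0 < x by rewrite invr_gt0.
  have tx : t k * x = 1 by rewrite mulfV// gt_eqF.
  have x1 : x <= 1 by rewrite invf_le1.
  have aE : alpha k = theta * x by [].
  have Uk0 := U0 k; have Vk0 := V0 k; have Yk0 := Y0 k.
  have scale u : u <= t k -> u * x <= 1 by move=> ut; rewrite -tx ler_wpM2r// ltW.
  have thx : theta * x <= 1 by exact: scale.
  have thmx : theta * mu * x <= 1 by exact: scale.
  have tT1x : 6 * x <= 1 - r.
    have -> : 6 * x = T1 * x * (1 - r).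
      by rewrite /T1 [RHS]mulrAC divfK// subr_eq0 eq_sym lt_eqF.
    by rewrite ler_piMl ?subr_ge0 ?(ltW r1)// scale.
  have tT2x : 2 * C * (kap + 2 * theta ^+ 2) * x <= 1 - r.
    have -> : 2 * C * (kap + 2 * theta ^+ 2) * x = T2 * x * (1 - r).
      by rewrite /T2 [RHS]mulrAC divfK// subr_eq0 eq_sym lt_eqF.
    by rewrite ler_piMl ?subr_ge0 ?(ltW r1)// scale.
  have tT3x : 2 * Cu * kap * x <= mu.
    have -> : 2 * Cu * kap * x = T3 * x * mu by rewrite /T3 [RHS]mulrAC divfK// gt_eqF.
    by rewrite ler_piMl ?(ltW mup)// scale.
  have al : alpha k <= a0 by rewrite /alpha ler_pdivrMr// mulrC -ler_pdivrMr.
  have Vx : V k <= kap * B * x ^+ 2.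
    have -> : V k = V k * t k ^+ 2 * x ^+ 2 by rewrite -mulrA -exprMn tx expr1n mulr1.
    by rewrite ler_wpM2r// sqr_ge0.
  have xx : x ^+ 2 <= x by rewrite expr2 ler_piMl// ltW.
  split.
  - apply: le_trans (HU al) _; rewrite aE.
    have thx0 : 0 <= theta * x by rewrite mulr_ge0// ltW.
    have f1 : (1 - theta * x * mu) * U k <= (1 - theta * x * mu) * B.
      by rewrite ler_wpM2l// subr_ge0 mulrAC.
    have f2 := ler_wpM2l Cup (ler_wpM2l thx0 Vx).
    have f3 := ler_wpM2r (mulr_ge0 thx0 (mulr_ge0 B0 (ltW x0))) tT3x.
    have f4 := ler_wpM2l (mulr_ge0 (ltW mup) (mulr_ge0 thx0 B0)) x1.
    have f5 := ler_wpM2r (mulr_ge0 thx0 (ltW bp)) thx.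
    have f6 := ler_wpM2l thx0 Br.
    move: f1 f2 f3 f4 f5 f6; lra.
  - have th20 : 0 <= C * theta ^+ 2 by rewrite mulr_ge0// sqr_ge0.
    have kB0 := mulr_ge0 kap0 B0.
    have x20 : 0 <= x ^+ 2 by exact: sqr_ge0.
    have hV' : V k.+1 <= (r * (kap * B) + C * theta ^+ 2 * B) * x ^+ 2.
      apply: le_trans (HV k) _; rewrite aE.
      have f1 := ler_wpM2l r0 Vx; have f2 := ler_wpM2l (mulr_ge0 th20 x20) YB.
      move: f1 f2; lra.
    (* The price of passing from the weight t^2 to the next one. *)
    rewrite tS; have ht : x ^+ 2 * (t k + 1) ^+ 2 = (1 + x) ^+ 2.
      by rewrite -exprMn mulrDr mulr1 mulrC tx.
    apply: le_trans (ler_wpM2r (sqr_ge0 (t k + 1)) hV') _; rewrite -[leLHS]mulrA ht.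
    have q1 : (1 + x) ^+ 2 <= 1 + 3 * x by lra.
    have q2 : r * (1 + x) ^+ 2 <= r'.
      have g1 := ler_wpM2l r0 q1; have g2 := ler_wpM2r (ltW x0) (ltW r1).
      by rewrite /r'; lra.
    have q3 : (1 + x) ^+ 2 <= 4 by lra.
    have g1 := ler_wpM2l kB0 q2; have g2 := ler_wpM2l (mulr_ge0 th20 B0) q3.
    have g3 := ler_wpM2r B0 (ler_wpM2r (ltW r'1) (_ : kap - 1 <= kap)).
    have {}g3 : 4 * C * theta ^+ 2 * B <= kap * (1 - r') * B.
      by rewrite kapE; apply: g3; rewrite gerBl.
    move: (r') g1 g2 g3 => rr; lra.
  - apply: le_trans (HY k) _; rewrite aE.
    have f1 := ler_wpM2l r0 YB.
    have f2 := ler_wpM2l Cp Vx.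
    have Cth0 : 0 <= C * (theta * x) ^+ 2 by rewrite mulr_ge0// sqr_ge0.
    have f3 := ler_wpM2l Cth0 YB; have f4 := ler_wpM2l Cth0 UB.
    have Ck0 : 0 <= C * (kap + 2 * theta ^+ 2) * B.
      by rewrite mulr_ge0// mulr_ge0// addr_ge0// mulr_ge0// sqr_ge0.
    have f5 := ler_wpM2l Ck0 xx.
    have f6 := ler_wpM2r B0 tT2x.
    move: f1 f2 f3 f4 f5 f6 Bs2; lra.
have [k||k Kk|c c0' hc] := @eventually_bounded V (fun k => (t k ^+ 2)^-1) K (kap * B) V0.
- by rewrite invr_gt0 exprn_gt0.
- exact: mulr_ge0.
- have := inv (k - K)%N; rewrite subnKC// => -[_ h _].
  by rewrite ler_pdivlMr// exprn_gt0.
by exists c.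
Qed.

Hypothesis thetamu : 1 < theta * mu.

Lemma optimality_rate : exists c, forall k,
  U k <= 2 * theta ^+ 2 * b / ((theta * mu - 1) * t k) + c / t k `^ (theta * mu).
Proof.
have [c3 c30 hV] := consensus_rate.
have thp := theta0; have mup := mu0; have bp := b0; have Cup := Cu0.
set a := theta * mu; have a1 : 0 < a - 1 by rewrite subr_gt0.
have a_gt0 : 0 <= a := mulr_ge0 (ltW thp) (ltW mup).
(* A/t balances the recursion at order t^-2: damping a A against noise theta^2 b leaves exactly A,
   the decrease of A/t. With 2 A a surplus of theta^2 b at that order remains. *)
pose A := theta ^+ 2 * b / (a - 1).
have AE : A * (a - 1) = theta ^+ 2 * b by rewrite /A divfK// gt_eqF.
have tb0 : 0 < theta ^+ 2 * b by rewrite mulr_gt0// exprn_gt0.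
have A0 : 0 < A by rewrite divr_gt0.
pose D := Cu * theta * c3.
have D0 : 0 <= D by rewrite /D !mulr_ge0// ltW.
(* Beyond it the contribution D/t^3 of V is below the surplus theta^2 b/t^2. *)
pose T1 := D / (theta ^+ 2 * b).
have T10 : 0 <= T1 by rewrite divr_ge0// ltW.
have th2 : 0 <= theta / a0 by rewrite divr_ge0 ?ltW.
have [K hK] := archimedean_bound m (1 + a + theta / a0 + T1).
have {}hK k : (K <= k)%N -> [/\ 1 <= t k, a <= t k, theta / a0 <= t k & T1 <= t k].
  move=> Kk; have := hK k Kk (ltW m0); rewrite -/(t k).
  move: (t k) (a) (theta / a0) (T1) a_gt0 th2 T10.
  by move=> *; split; lra.
pose c := U K * t K `^ a.
have c0 : 0 <= c by rewrite mulr_ge0// powR_ge0.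
have inv j : let k := (K + j)%N in U k <= 2 * A / t k + c * (t k `^ a)^-1.
  elim: j => [|j].
    rewrite addn0 /= /c mulfK ?gt_eqF ?powR_gt0// lerDr.
    by rewrite divr_ge0 ?(ltW (t0 _))// mulr_ge0// ltW.
  rewrite addnS; set k := (K + j)%N; move=> /= UB.
  have Kk : (K <= k)%N by exact: leq_addr.
  have [t1 ta ta0 tT1] := hK k Kk.
  set x := (t k)^-1.
  have x0 : 0 < x by rewrite invr_gt0.
  have tx : t k * x = 1 by rewrite mulfV// gt_eqF.
  have aE : alpha k = theta * x by [].
  have scale u : u <= t k -> u * x <= 1 by move=> ut; rewrite -tx ler_wpM2r// ltW.
  have al : alpha k <= a0 by rewrite /alpha ler_pdivrMr// mulrC -ler_pdivrMr.
  have ax : a * x <= 1 by exact: scale.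
  have Dx : D * x <= theta ^+ 2 * b.
    have -> : D * x = T1 * x * (theta ^+ 2 * b) by rewrite /T1 [RHS]mulrAC divfK// gt_eqF.
    by rewrite ler_piMl ?(ltW tb0)// scale.
  have Vx : V k <= c3 * x ^+ 2 by have := hV k; rewrite -exprVn.
  have pw := powR_inv_step a_gt0 ta (t0 k); rewrite -/x in pw.
  rewrite tS -/x; have t1S0 : 0 < t k + 1 by rewrite addr_gt0.
  apply: le_trans (HU al) _; rewrite aE.
  have thx0 : 0 <= theta * x by rewrite mulr_ge0// ltW.
  have f1 : (1 - theta * x * mu) * U k <=
      (1 - theta * x * mu) * (2 * A * x + c * (t k `^ a)^-1).
    by rewrite ler_wpM2l// subr_ge0 mulrAC.
  have f2 := ler_wpM2l Cup (ler_wpM2l thx0 Vx).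
  have f3 := ler_wpM2l c0 pw.
  have f4 := ler_wpM2r (sqr_ge0 x) Dx.
  have f5 : 2 * A * x - 2 * A * x ^+ 2 <= 2 * A / (t k + 1).
    rewrite ler_pdivlMr// -subr_ge0.
    have -> : 2 * A - (2 * A * x - 2 * A * x ^+ 2) * (t k + 1) =
      2 * A * x ^+ 2 + 2 * A * (1 - t k * x) + 2 * A * x * (t k * x - 1) by ring.
    by rewrite tx subrr !mulr0 !addr0 mulr_ge0 ?sqr_ge0// mulr_ge0// ltW.
  have f6 : A * (a - 1) * x ^+ 2 = theta ^+ 2 * b * x ^+ 2 by rewrite AE.
  move: f1 f2 f3 f4 f5 f6; rewrite /D /a; move: ((t k `^ _)^-1) => P1.
  move: ((_ `^ _)^-1) => P2; lra.
(* The steps before [K] go into the coefficient of t^-a, so the leading term is untouched. The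
   excess over it may be negative, hence the truncation at 0. *)
have [k|k||k Kk|c' c'0 hc] := @eventually_bounded
    (fun k => Num.max 0 (U k - 2 * A / t k)) (fun k => (t k `^ a)^-1) K c.
- by rewrite le_max lexx.
- by rewrite invr_gt0 powR_gt0.
- by [].
- have := inv (k - K)%N; rewrite subnKC//= => h.
  by rewrite ge_max lerBlDl h mulr_ge0 ?invr_ge0 ?powR_ge0.
exists c' => k; have := hc k; rewrite ge_max => /andP[_]; rewrite lerBlDl.
suff -> : 2 * A / t k = 2 * theta ^+ 2 * b / ((a - 1) * t k) by [].
by rewrite /A; field; rewrite !gt_eqF.
Qed.

End rates.

(** * Independence and noise *)

Section measurable_row_vectors.
Context {R : realType} {n : nat}.

Lemma measurable_coord (j : 'I_n) :
  measurable_fun setT (fun v : 'rV[R]_n => v 0 j).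
Proof.
move=> _ Y mY; rewrite setTI; apply: sub_sigma_algebra => /=.
rewrite -bigcup_seq /=; exists j => /=; first by rewrite mem_index_enum.
by exists Y => //; rewrite setTI.
Qed.

Lemma measurable_fun_rV {d} {T : measurableType d} (h : T -> 'rV[R]_n) :
  (forall j, measurable_fun setT (fun w => h w 0 j)) -> measurable_fun setT h.
Proof.
move=> mh; apply: (@measurability _ _ _ _ _ _
  (\big[setU/set0]_(i < n) preimage_set_system setT (fun v : 'rV[R]_n => v 0 i)
     measurable)) => // _ [C + <-].
rewrite -bigcup_seq /= => -[j _ [Y mY <-]].
by rewrite !setTI; have := mh j measurableT _ mY; rewrite setTI.
Qed.

End measurable_row_vectors.

Section independence.
Context {d d' d''} {T : measurableType d} {E : measurableType d'}
  {V : measurableType d''} {R : realType} (P : probability T R).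

Definition independent2 (Z : T -> E) (X : T -> V) : Prop :=
  forall A B, measurable A -> measurable B ->
    P (Z @^-1` A `&` X @^-1` B) = (P (Z @^-1` A) * P (X @^-1` B))%E.

Context (Z : {mfun T >-> E}) (X : {mfun T >-> V}).
Hypothesis ZX : independent2 Z X.

Let ZXfun (w : T) := (Z w, X w).
Let mZX : measurable_fun setT ZXfun.
Proof. exact: measurable_fun_pair. Qed.
HB.instance Definition _ := isMeasurableFun.Build _ _ _ _ ZXfun mZX.

(** Independence is agreement of the joint and the product law on rectangles; uniqueness of the
    product measure extends it to all measurable sets. *)
Let pairE (A : set (E * V)) : measurable A ->
  (distribution P Z \x distribution P X)%E A = distribution P ZXfun A.
Proof.
apply: product_measure_unique => A1 A2 mA1 mA2.
rewrite /distribution /pushforward /= -ZX//.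
Qed.

Lemma ge0_integral_independent (F : E * V -> \bar R) :
  measurable_fun [set: E * V] F -> (forall x, (0 <= F x)%E) ->
  (\int[P]_w F (Z w, X w) =
   \int[distribution P Z]_z \int[distribution P X]_x F (z, x))%E.
Proof.
move=> mF F0; rewrite -fubini_tonelli1//.
transitivity (\int[distribution P ZXfun]_y F y)%E.
  by rewrite ge0_integral_distribution.
by apply: eq_measure_integral => //= A mA _; rewrite pairE.
Qed.

(** Fubini needs integrability under the product law; the nonnegative case applied to the absolute
    value of [F] provides it. *)
Lemma integral_independent (F : E * V -> \bar R) :
  measurable_fun [set: E * V] F -> P.-integrable setT (fun w => F (Z w, X w)) ->
  (\int[P]_w F (Z w, X w) =
   \int[distribution P Z]_z \int[distribution P X]_x F (z, x))%E.
Proof.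
move=> mF iF; rewrite integral12_prod_meas1.
  transitivity (\int[distribution P ZXfun]_y F y)%E.
    by rewrite integral_distribution.
  by apply: eq_measure_integral => //= A mA _; rewrite pairE.
apply/integrable12ltyP => //.
have mA : measurable_fun [set: E * V] (abse \o F) by exact: measurableT_comp.
rewrite -(ge0_integral_independent mA) => [|x]; last exact: abse_ge0.
by case/integrableP : iF.
Qed.

End independence.

Section square_integrability.
Context {R : realType}.

Lemma measurable_sqnorm d (T : measurableType d) a b (A : T -> 'M[R]_(a, b)) :
  (forall i j, measurable_fun setT (fun w => A w i j)) ->
  measurable_fun setT (fun w => norm2 (A w) ^+ 2).
Proof.
move=> mA; under eq_fun do rewrite sqnormE.
by apply: measurable_sum => i; apply: measurable_sum => j; exact: measurable_funX.
Qed.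

Lemma Lfun2P d (T : measurableType d) (mu : {measure set T -> \bar R}) (X : T -> R) :
  measurable_fun setT X -> (\int[mu]_w (X w ^+ 2)%:E < +oo)%E ->
  X \in Lfun mu 2%:E.
Proof.
move=> mX X2; rewrite inE; apply/andP; split; rewrite inE//=.
rewrite /finite_norm unlock /Lnorm poweR_lty//.
under eq_integral => x _ do rewrite /= powR_mulrn// -normrX ger0_norm ?sqr_ge0//.
exact: X2.
Qed.

Lemma Lfun_measurable d (T : measurableType d) (mu : {measure set T -> \bar R}) r
    (X : T -> R) :
  X \in Lfun mu r -> measurable_fun setT X.
Proof. by rewrite inE => /andP[/[!inE]/= ? _]. Qed.

End square_integrability.

Section noise.
Context {R : realType} {p q : nat} {d d'} {T : measurableType d}
  {E : measurableType d'} (P : probability T R).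
Context (Z : {mfun T >-> E}) (xi : {mfun T >-> 'rV[R]_q}).
Hypothesis Zxi : independent2 P Z xi.
Context (g : 'rV[R]_p -> 'rV[R]_q -> 'rV[R]_p) (h : 'rV[R]_p -> 'rV[R]_p)
  (sigma : R).
Hypothesis mg : measurable_fun setT (fun z : 'rV[R]_p * 'rV[R]_q => g z.1 z.2).
Hypothesis gh : forall x j, ('E_P[fun w => (g x (xi w) 0 j)%R] = (h x 0 j)%:E)%E.
Hypothesis gvar : forall x,
  ('E_P[fun w => (norm2 (g x (xi w) - h x) ^+ 2)%R] <= (sigma ^+ 2)%:E)%E.

Let mgj j : measurable_fun setT (fun z : 'rV[R]_p * 'rV[R]_q => g z.1 z.2 0 j).
Proof. exact: (measurableT_comp (measurable_coord j) mg). Qed.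

Let mgxj x j : measurable_fun setT (fun z : 'rV[R]_q => g x z 0 j).
Proof.
have mx : measurable_fun setT (fun z : 'rV[R]_q => (x, z)).
  exact: measurable_fun_pair.
exact: (measurableT_comp (mgj j) mx).
Qed.

(** The variance bound makes the centred value square integrable, hence integrable under a
    probability; the constant is added back. *)
Let gradient_Lfun x j : (fun w => g x (xi w) 0 j) \in Lfun P 1.
Proof.
have mgx i : measurable_fun setT (fun w => g x (xi w) 0 i).
  exact: (measurableT_comp (mgxj x i)).
rewrite (_ : (fun w => _) = (fun w => g x (xi w) 0 j - h x 0 j) \+ cst (h x 0 j)); last first.
  by apply/funext => w /=; rewrite subrK.
apply: rpredD; last exact: Lfun_cst.
apply: Lfun_subset12; first by rewrite fin_num_measure.
apply: Lfun2P; first exact: measurable_funB.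
apply: le_lt_trans (ltry (sigma ^+ 2)); apply: le_trans (gvar x); rewrite unlock.
apply: ge0_le_integral => //.
- by move=> w _; rewrite lee_fin sqr_ge0.
- by apply/measurable_EFinP; apply: measurable_funX; exact: measurable_funB.
- apply/measurable_EFinP; apply: measurable_sqnorm => i k; rewrite (ord1 i).
  by under eq_fun do rewrite !mxE; exact: measurable_funB.
- move=> w _; rewrite lee_fin sqnorm_rV (bigD1 j)//= !mxE lerDl.
  by rewrite sumr_ge0// => i _; exact: sqr_ge0.
Qed.

Let mean_gradientE x j :
  ((h x 0 j)%:E = \int[distribution P xi]_z (g x z 0 j)%:E)%E.
Proof.
rewrite -gh unlock integral_distribution//; first exact/measurable_EFinP.
exact/Lfun1_integrable/gradient_Lfun.
Qed.

(** [h] is the integral of the jointly measurable [g] over the law of the sample, so Tonelli applied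
    to the positive and negative parts makes it measurable in the parameter. *)
Lemma measurable_mean_gradient : measurable_fun setT h.
Proof.
apply: measurable_fun_rV => j; apply/measurable_EFinP.
rewrite /comp; under eq_fun do rewrite mean_gradientE integralE.
pose F (z : 'rV[R]_p * 'rV[R]_q) := (g z.1 z.2 0 j)%:E.
have mF : measurable_fun setT F by exact/measurable_EFinP.
have mFp : measurable_fun setT F^\+%E by exact: measurable_funepos.
have mFn : measurable_fun setT F^\-%E by exact: measurable_funeneg.
apply: emeasurable_funB.
  have := @measurable_fun_fubini_tonelli_F _ _ _ _ _ (distribution P xi) _ mFp
    (fun x => funepos_ge0 _ x).
  by apply: eq_measurable_fun => x _; apply: eq_integral => y _; rewrite !funeposE.
have := @measurable_fun_fubini_tonelli_F _ _ _ _ _ (distribution P xi) _ mFn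
  (fun x => funeneg_ge0 _ x).
by apply: eq_measurable_fun => x _; apply: eq_integral => y _; rewrite !funenegE.
Qed.

Context (X : E -> 'rV[R]_p).
Hypothesis mX : measurable_fun setT X.

Let e (z : E * 'rV[R]_q) : 'rV[R]_p := g (X z.1) z.2 - h (X z.1).

Let me j : measurable_fun setT (fun z => e z 0 j).
Proof.
rewrite /e; under eq_fun do rewrite !mxE; apply: measurable_funB.
  have m1 : measurable_fun setT (fun z : E * 'rV[R]_q => (X z.1, z.2)).
    apply: measurable_fun_pair => //.
    exact: (measurableT_comp mX measurable_fst).
  exact: (measurableT_comp (mgj j) m1).
apply: (measurableT_comp (measurable_coord j)).
apply: (measurableT_comp measurable_mean_gradient).
exact: (measurableT_comp mX measurable_fst).
Qed.

(** The bound is assumed at deterministic points only. Under the product law the inner integral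
    freezes the point [X z], where it applies. *)
Lemma noise_variance :
  ('E_P[fun w => (norm2 (g (X (Z w)) (xi w) - h (X (Z w))) ^+ 2)%R]
    <= (sigma ^+ 2)%:E)%E.
Proof.
pose F (z : E * 'rV[R]_q) := (norm2 (e z) ^+ 2)%:E.
have mF : measurable_fun setT F.
  apply/measurable_EFinP/measurable_sqnorm => i j; rewrite (ord1 i).
  exact: me.
have F0 x : (0 <= F x)%E by rewrite lee_fin sqr_ge0.
rewrite unlock (ge0_integral_independent Zxi mF F0).
apply: (@le_trans _ _ (\int[distribution P Z]_z (sigma ^+ 2)%:E)%E).
  apply: ge0_le_integral => //.
  - by move=> z _; exact: integral_ge0.
  - exact: (@measurable_fun_fubini_tonelli_F _ _ _ _ _ (distribution P xi) _ mF F0).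
  - move=> z _; apply: le_trans (gvar (X z)).
    rewrite unlock ge0_integral_distribution//.
    have mz : measurable_fun setT (fun y : 'rV[R]_q => (z, y)).
      exact: measurable_fun_pair.
    exact: (measurableT_comp mF mz).
by rewrite integral_cst// [X in (_ * X)%E](@probability_setT _ _ _ (distribution P Z)) mule1.
Qed.

Lemma noise_Lfun j :
  (fun w => (g (X (Z w)) (xi w) - h (X (Z w))) 0 j) \in Lfun P 2%:E.
Proof.
have mZx : measurable_fun setT (fun w => (Z w, xi w)).
  exact: measurable_fun_pair.
have mej i := measurableT_comp (me i) mZx.
apply: Lfun2P; first exact: mej.
apply: le_lt_trans (ltry (sigma ^+ 2)); apply: le_trans noise_variance.
rewrite unlock; apply: ge0_le_integral => //.
- by move=> w _; rewrite lee_fin sqr_ge0.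
- by apply/measurable_EFinP; apply: measurable_funX; exact: mej.
- apply/measurable_EFinP; apply: measurable_sqnorm => i k; rewrite (ord1 i).
  exact: mej.
- move=> w _; rewrite lee_fin sqnorm_rV (bigD1 j)//= lerDl.
  by rewrite sumr_ge0// => i _; exact: sqr_ge0.
Qed.

(** With [z] frozen, [Phi z] is a constant factor of a centred variable, so the inner integral
    vanishes; two square-integrable factors justify Fubini. *)
Lemma noise_uncorrelated j (Phi : E -> R) :
  measurable_fun setT Phi -> (fun w => Phi (Z w)) \in Lfun P 2%:E ->
  \int[P]_w (Phi (Z w) * (g (X (Z w)) (xi w) - h (X (Z w))) 0 j) = 0.
Proof.
move=> mPhi L2Phi.
pose F (z : E * 'rV[R]_q) := (Phi z.1 * e z 0 j)%:E.
have mF : measurable_fun setT F.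
  apply/measurable_EFinP; apply: measurable_funM; last exact: me.
  exact: (measurableT_comp mPhi measurable_fst).
have iF : P.-integrable setT (fun w => F (Z w, xi w)).
  have /Lfun1_integrable := Lfun2_mul_Lfun1 L2Phi (noise_Lfun j).
  exact.
rewrite /Rintegral (integral_independent Zxi mF iF).
rewrite integral0_eq// => z _.
have Lz : (fun w => g (X z) (xi w) 0 j - h (X z) 0 j) \in Lfun P 1.
  have -> : (fun w => g (X z) (xi w) 0 j - h (X z) 0 j) =
      (fun w => g (X z) (xi w) 0 j) \+ cst (- h (X z) 0 j) by [].
  by apply: rpredD; [exact: gradient_Lfun|exact: Lfun_cst].
have eE w : F (z, xi w) =
    ((Phi z)%:E * (g (X z) (xi w) 0 j - h (X z) 0 j)%:E)%E.
  by rewrite /F /e /= !mxE EFinM.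
rewrite integral_distribution; first last.
- rewrite /comp; under eq_fun do rewrite eE.
  by apply: integrableZl => //; exact/Lfun1_integrable.
- have mz : measurable_fun setT (fun y : 'rV[R]_q => (z, y)).
    exact: measurable_fun_pair.
  exact: (measurableT_comp mF mz).
rewrite /comp; under eq_integral do rewrite eE.
rewrite integralZl//; last exact/Lfun1_integrable.
rewrite (_ : (\int[P]_w _)%E = 0%E) ?mule0//.
under eq_integral do rewrite EFinB.
rewrite integralB_EFin//=; last exact: finite_measure_integrable_cst.
- have := gh (X z) j; rewrite unlock => ->.
  by rewrite integral_cst// [X in (_ * X)%E](@probability_setT _ _ _ P) mule1 subee.
- exact/Lfun1_integrable/gradient_Lfun.
Qed.
End noise.

(** * Independence of one sample from all the others *)

Section mutual_independence.
Context {d d'} {T : measurableType d} {V : measurableType d'} {R : realType}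
  (P : probability T R) {I : eqType} (X : I -> T -> V) (i0 : I).
Hypothesis mX : forall i, measurable_fun setT (X i).

(** A pi-system generating the sigma-algebra of the family without index [i0]. Its members are
    finite intersections, which is what mutual independence evaluates. *)
Definition cylinders_except : set (set T) :=
  [set A | exists s B, [/\ uniq s, i0 \notin s, forall i, measurable (B i)
    & A = \big[setI/setT]_(i <- s) (X i @^-1` B i)]].

Notation G := cylinders_except.
Notation E := (g_sigma_algebraType G).

Let G_measurable : G `<=` measurable.
Proof.
move=> _ [s [B [_ _ mB ->]]]; apply: bigsetI_measurable => i _.
by rewrite -[X in measurable X]setTI; exact: mX.
Qed.

(** The identity into the coarser sigma-algebra turns a sub-sigma-algebra into a random variable, as
    the lemmas on independent pairs require. *)
Lemma measurable_id_except : measurable_fun setT (id : T -> E).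
Proof.
move=> _ A mA; rewrite setTI preimage_id.
by move: A mA; apply: smallest_sub => //; exact: sigma_algebra_measurable.
Qed.

Lemma measurable_except i : i != i0 -> measurable_fun setT (X i : E -> V).
Proof.
move=> ii0 _ B mB; rewrite setTI; apply: sub_sigma_algebra.
exists [:: i], (fun=> B); split => //; last by rewrite big_seq1.
by rewrite inE eq_sym.
Qed.

Let mem_bigsetI (s : seq I) (F : I -> set T) w :
  (\big[setI/setT]_(i <- s) F i) w <-> {in s, forall i, F i w}.
Proof.
elim: s => [|i s IH]; first by rewrite big_nil.
rewrite big_cons; split => [[Fi /IH Fs] k|Fs].
  by rewrite inE => /predU1P[->//|]; exact: Fs.
split; first by apply: Fs; rewrite mem_head.
by apply/IH => k ks; apply: Fs; rewrite inE ks orbT.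
Qed.

Let G_setI : setI_closed G.
Proof.
move=> _ _ [s1 [B1 [u1 n1 m1 ->]]] [s2 [B2 [u2 n2 m2 ->]]].
(* Indices occurring in only one of the two cylinders are padded with the full set. *)
exists (undup (s1 ++ s2)), (fun i => (if i \in s1 then B1 i else setT)
  `&` (if i \in s2 then B2 i else setT)); split.
- exact: undup_uniq.
- by rewrite mem_undup mem_cat negb_or n1.
- by move=> i; apply: measurableI; case: ifP.
- rewrite eqEsubset; split => w.
    move=> [/mem_bigsetI h1 /mem_bigsetI h2]; apply/mem_bigsetI => i _.
    by split; case: ifPn => // hi; [exact: h1|exact: h2].
  move=> /mem_bigsetI h; split; apply/mem_bigsetI => i hi; have := h i;
    by rewrite mem_undup mem_cat hi ?orbT /preimage /= => /(_ isT) [].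
Qed.

(** For fixed [B] both sides are finite measures in [A]; they agree on the pi-system of cylinders,
    hence on the sigma-algebra it generates. *)
Lemma independent_except : mutually_independent P X ->
  independent2 P (id : T -> E) (X i0).
Proof.
move=> hX A B mA mB; rewrite preimage_id.
have mB0 : measurable (X i0 @^-1` B).
  by rewrite -[X in measurable X]setTI; exact: mX.
have r0 : 0 <= fine (P (X i0 @^-1` B)) by exact: fine_ge0.
pose m2 := mscale (NngNum r0) P.
have m2E C : m2 C = (P C * P (X i0 @^-1` B))%E.
  by rewrite /m2 /mscale /= muleC fineK// fin_num_measure.
rewrite -m2E -[LHS]/(mrestr P mB0 A).
apply: (g_sigma_algebra_measure_unique G G_measurable (fun=> setT)) => //.
- by move=> _; exists [::], (fun=> setT); split; rewrite ?big_nil.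
- by rewrite bigcup_const//; exists 0%N.
- move=> _ [s [C [us i0s mC ->]]].
  rewrite [RHS]m2E -[LHS]/(P (_ `&` X i0 @^-1` B)) setIC.
  pose C' i := if i == i0 then B else C i.
  have C'E i : i \in s -> C' i = C i.
    by rewrite /C' => si; case: eqP si i0s => // -> ->.
  have C'0 : C' i0 = B by rewrite /C' eqxx.
  have mC' i : measurable (C' i) by rewrite /C'; case: ifP.
  rewrite hX//.
  have -> : X i0 @^-1` B `&` \big[setI/setT]_(i <- s) X i @^-1` C i =
      \big[setI/setT]_(i <- i0 :: s) X i @^-1` C' i.
    by rewrite big_cons C'0; congr (_ `&` _); apply: eq_big_seq => i /C'E ->.
  rewrite hX//= ?i0s// big_cons C'0 muleC; congr (_ * _)%E.
  by apply: eq_big_seq => i /C'E ->.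
- by move=> _; rewrite -[X in (X < _)%E]/(P (_ `&` _)) ltey_eq fin_num_measure// setTI.
Qed.
End mutual_independence.

(** * Random matrices with square-integrable entries *)

Section matrix_random_variables.
Context {R : realType} {d : measure_display} {T : measurableType d}.

Definition measurable_mx {a b} (A : T -> 'M[R]_(a, b)) : Prop :=
  forall i j, measurable_fun setT (fun w => A w i j).

Lemma measurable_mxD a b (A B : T -> 'M[R]_(a, b)) :
  measurable_mx A -> measurable_mx B -> measurable_mx (fun w => A w + B w).
Proof.
by move=> mA mB i j; under eq_fun do rewrite mxE; exact: measurable_funD.
Qed.

Lemma measurable_mxZ a b (t : R) (A : T -> 'M[R]_(a, b)) :
  measurable_mx A -> measurable_mx (fun w => t *: A w).
Proof.
by move=> mA i j; under eq_fun do rewrite mxE; exact: measurable_funM.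
Qed.

Lemma measurable_mxB a b (A B : T -> 'M[R]_(a, b)) :
  measurable_mx A -> measurable_mx B -> measurable_mx (fun w => A w - B w).
Proof.
by move=> mA mB i j; under eq_fun do rewrite !mxE; exact: measurable_funB.
Qed.

Lemma measurable_mxM a b c (M : 'M[R]_(a, b)) (A : T -> 'M[R]_(b, c)) :
  measurable_mx A -> measurable_mx (fun w => M *m A w).
Proof.
move=> mA i j; under eq_fun do rewrite mxE.
by apply: measurable_sum => k; exact: measurable_funM.
Qed.

Lemma measurable_mx_row a b (A : T -> 'M[R]_(a, b)) i :
  measurable_mx A -> measurable_fun setT (fun w => row i (A w)).
Proof.
by move=> mA; apply: measurable_fun_rV => j; under eq_fun do rewrite mxE; exact: mA.
Qed.

Context (P : probability T R).

Notation Ex X := (\int[P]_w (X w)%R).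

Lemma Lfun1D (X Y : T -> R) : X \in Lfun P 1 -> Y \in Lfun P 1 ->
  (fun w => X w + Y w) \in Lfun P 1.
Proof. by move=> hX hY; apply: rpredD hX hY. Qed.

Lemma Lfun1Z c (X : T -> R) : X \in Lfun P 1 -> (fun w => c * X w) \in Lfun P 1.
Proof. by move=> hX; apply: rpredZ hX. Qed.

Lemma Lfun1_cst c : (fun=> c) \in Lfun P 1.
Proof. exact: Lfun_cst. Qed.

Lemma expectation_Rintegral (X : T -> R) : X \in Lfun P 1 ->
  ('E_P[X] = (Ex X)%:E)%E.
Proof.
by move=> hX; rewrite -[LHS]fineK ?expectation_fin_num// unlock.
Qed.

Lemma RexpectationD (X Y : T -> R) : X \in Lfun P 1 -> Y \in Lfun P 1 ->
  Ex (fun w => X w + Y w) = Ex X + Ex Y.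
Proof. by move=> /Lfun1_integrable hX /Lfun1_integrable hY; rewrite RintegralD. Qed.

Lemma RexpectationZ c (X : T -> R) : X \in Lfun P 1 -> Ex (fun w => c * X w) = c * Ex X.
Proof. by move=> /Lfun1_integrable hX; rewrite RintegralZl. Qed.

Lemma Rexpectation_le (X Y : T -> R) : X \in Lfun P 1 -> Y \in Lfun P 1 ->
  (forall w, X w <= Y w) -> Ex X <= Ex Y.
Proof.
by move=> /Lfun1_integrable hX /Lfun1_integrable hY XY; exact: le_Rintegral.
Qed.

Lemma Rexpectation_ge0 (X : T -> R) : (forall w, 0 <= X w) -> 0 <= Ex X.
Proof. by move=> X0; exact: Rintegral_ge0. Qed.

Lemma Rexpectation_sum (I : finType) (F : I -> T -> R) : (forall i, F i \in Lfun P 1) ->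
  Ex (fun w => \sum_i F i w) = \sum_i Ex (F i) /\ (fun w => \sum_i F i w) \in Lfun P 1.
Proof.
move=> hF; elim: (index_enum I) => [|i l [IH1 IH2]].
  under eq_Rintegral do rewrite big_nil.
  rewrite big_nil Rintegral_cst// mul0r; split => //.
  by rewrite (_ : (fun=> _) = fun=> 0) ?Lfun1_cst//; apply/funext => w; rewrite big_nil.
have E : (fun w => \sum_(k <- i :: l) F k w) = (fun w => F i w + \sum_(k <- l) F k w).
  by apply/funext => w; rewrite big_cons.
by rewrite E big_cons RexpectationD// IH1; split => //; exact: Lfun1D.
Qed.

Lemma Lfun2D (X Y : T -> R) : X \in Lfun P 2%:E -> Y \in Lfun P 2%:E ->
  (fun w => X w + Y w) \in Lfun P 2%:E.
Proof.
have p1 : (1 <= 2%:E :> \bar R)%E by rewrite lee_fin ler1n.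
by move=> hX hY; have [_ add] := Lfun_addr_closed P p1; exact: (add _ _ hX hY).
Qed.

Lemma Lfun2Z c (X : T -> R) : X \in Lfun P 2%:E -> (fun w => c * X w) \in Lfun P 2%:E.
Proof.
move=> hX; under eq_fun do rewrite mulrC.
by apply: (Lfun_scale _ _ hX); rewrite ler1n.
Qed.

Lemma Lfun2_sum (I : finType) (F : I -> T -> R) : (forall i, F i \in Lfun P 2%:E) ->
  (fun w => \sum_i F i w) \in Lfun P 2%:E.
Proof.
move=> hF; elim: (index_enum I) => [|i l IH].
  by under eq_fun do rewrite big_nil; exact: Lfun_cst.
by under eq_fun do rewrite big_cons; exact: Lfun2D.
Qed.

Definition L2mx {a b} (A : T -> 'M[R]_(a, b)) : Prop :=
  forall i j, (fun w => A w i j) \in Lfun P 2%:E.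

Lemma L2mx_cst a b (A : 'M[R]_(a, b)) : L2mx (fun=> A).
Proof. by move=> i j; exact: Lfun_cst. Qed.

Lemma L2mxD a b (A B : T -> 'M[R]_(a, b)) :
  L2mx A -> L2mx B -> L2mx (fun w => A w + B w).
Proof. by move=> hA hB i j; under eq_fun do rewrite mxE; exact: Lfun2D. Qed.

Lemma L2mxZ a b (t : R) (A : T -> 'M[R]_(a, b)) :
  L2mx A -> L2mx (fun w => t *: A w).
Proof. by move=> hA i j; under eq_fun do rewrite mxE; exact: Lfun2Z. Qed.

Lemma L2mxB a b (A B : T -> 'M[R]_(a, b)) :
  L2mx A -> L2mx B -> L2mx (fun w => A w - B w).
Proof.
move=> hA /(L2mxZ (-1)) hB i j.
by under eq_fun do rewrite -scaleN1r; exact: (L2mxD hA hB).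
Qed.

Lemma L2mxM a b c (M : 'M[R]_(a, b)) (A : T -> 'M[R]_(b, c)) :
  L2mx A -> L2mx (fun w => M *m A w).
Proof.
move=> hA i j; under eq_fun do rewrite mxE.
by apply: Lfun2_sum => k; exact: Lfun2Z.
Qed.

Lemma L2mx_mean a b (A : T -> 'M[R]_(a, b)) : L2mx A -> L2mx (fun w => row_mean (A w)).
Proof. by move=> hA; apply: L2mxZ; exact: L2mxM. Qed.

Lemma L2mx_deviation a b (A : T -> 'M[R]_(a, b)) :
  L2mx A -> L2mx (fun w => deviation (A w)).
Proof. by move=> hA; apply: L2mxB => //; apply: L2mxM; exact: L2mx_mean. Qed.

Lemma L2mx_sqnorm a b (A : T -> 'M[R]_(a, b)) :
  L2mx A -> (fun w => sqnorm (A w)) \in Lfun P 1.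
Proof.
move=> hA; under eq_fun do rewrite sqnormE.
by apply: (Rexpectation_sum _).2 => i; apply: (Rexpectation_sum _).2 => j; exact: Lfun2_mul_Lfun1.
Qed.

(** Carries square integrability through Lipschitz maps, in particular from iterates to
    gradients. *)
Lemma L2mx_dominated a b a' b' (A : T -> 'M[R]_(a, b)) (B : T -> 'M[R]_(a', b')) c :
  measurable_mx A -> L2mx B -> (forall w, sqnorm (A w) <= c * sqnorm (B w)) -> L2mx A.
Proof.
move=> mA hB AB i j; apply: Lfun2P; first exact: mA.
have hcB : (fun w => c * sqnorm (B w)) \in Lfun P 1 by exact/Lfun1Z/L2mx_sqnorm.
apply: le_lt_trans (ltry (Ex (fun w => c * sqnorm (B w)))).
rewrite -expectation_Rintegral// unlock; apply: ge0_le_integral => //.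
- by move=> w _; rewrite lee_fin sqr_ge0.
- by apply/measurable_EFinP; apply: measurable_funX; exact: mA.
- by apply/measurable_EFinP; exact: Lfun_measurable hcB.
- move=> w _; rewrite lee_fin; apply: le_trans (AB w).
  rewrite sqnormE (bigD1 i)//= (bigD1 j)//= -addrA lerDl addr_ge0//.
    by apply: sumr_ge0 => k _; exact: sqr_ge0.
  by apply: sumr_ge0 => k _; apply: sumr_ge0 => l _; exact: sqr_ge0.
Qed.

End matrix_random_variables.

(** * The iterates as random variables *)

Section dsgt_recursion.
Context {R : realType} {n p q : nat} (W : 'M[R]_n) (alpha : nat -> R)
  (g : 'I_n -> 'rV[R]_p -> 'rV[R]_q -> 'rV[R]_p) (x0 : 'I_n -> 'rV[R]_p).
Implicit Types z : 'I_n -> nat -> 'rV[R]_q.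

Definition dsgt_y z k : 'M[R]_(n, p) := \matrix_(i < n) (dsgt W alpha g x0 z k).2 i.

Notation X := (dsgt_x W alpha g x0).

Definition dsgt_g z k : 'M[R]_(n, p) := \matrix_(i < n) g i (row i (X z k)) (z i k).

Lemma dsgt_xS z k : X z k.+1 = W *m (X z k - alpha k *: dsgt_y z k).
Proof.
rewrite /dsgt_x /dsgt_y /=; case: (dsgt _ _ _ _ _ _) => x y /=.
apply/row_matrixP => i; rewrite rowK row_mul; apply/rowP => j.
rewrite summxE mxE; apply: eq_bigr => l _; by rewrite !mxE.
Qed.

Lemma dsgt_y0 z : dsgt_y z 0 = dsgt_g z 0.
Proof. by apply/row_matrixP => i; rewrite !rowK. Qed.

Lemma dsgt_yS z k : dsgt_y z k.+1 = W *m dsgt_y z k + dsgt_g z k.+1 - dsgt_g z k.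
Proof.
apply/row_matrixP => i; rewrite linearB linearD /= !rowK /dsgt_x /dsgt_y /=.
case: (dsgt _ _ _ _ _ _) => x y /=; congr (_ + _ - _).
apply/rowP => j; rewrite summxE !mxE; apply: eq_bigr => l _; by rewrite !mxE.
Qed.

(** The gradient-tracking invariant: averaging removes [W], and the gradient increments
    telescope. *)
Lemma dsgt_tracking (e : rel 'I_n) z k : mixing_matrix e W ->
  row_mean (dsgt_y z k) = row_mean (dsgt_g z k).
Proof.
move=> Wmix; elim: k => [|k IH]; first by rewrite dsgt_y0.
rewrite dsgt_yS row_meanD row_meanN row_meanD (row_mean_mix Wmix) IH.
by rewrite addrAC subrr add0r.
Qed.

Hypothesis mg : forall i,
  measurable_fun setT (fun z : 'rV[R]_p * 'rV[R]_q => g i z.1 z.2).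

Lemma measurable_dsgt_g {d} {E : measurableType d} (z : E -> 'I_n -> nat -> 'rV[R]_q) k :
  (forall i, measurable_fun setT (fun w => z w i k)) ->
  measurable_mx (fun w => X (z w) k) -> measurable_mx (fun w => dsgt_g (z w) k).
Proof.
move=> mz mX i j; under eq_fun do rewrite mxE.
have mpair : measurable_fun setT (fun w => (row i (X (z w) k), z w i k)).
  by apply: measurable_fun_pair; [exact: measurable_mx_row|exact: mz].
exact: (measurableT_comp (measurable_coord j) (measurableT_comp (mg i) mpair)).
Qed.

(** The iterate at [k] reads samples strictly before [k], the tracker also those at [k]; this offset
    makes the noise at [k] fresh for the iterate. The space [E] is arbitrary so that coarser
    sigma-algebras on the sample space can be used. *)
Lemma measurable_dsgt {d} {E : measurableType d} (z : E -> 'I_n -> nat -> 'rV[R]_q) k :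
  ((forall i l, (l < k)%N -> measurable_fun setT (fun w => z w i l)) ->
    measurable_mx (fun w => X (z w) k)) /\
  ((forall i l, (l <= k)%N -> measurable_fun setT (fun w => z w i l)) ->
    measurable_mx (fun w => dsgt_y (z w) k)).
Proof.
elim: k => [|k [IHx IHy]].
  have mX : measurable_mx (fun w => X (z w) 0).
    by move=> i j; under eq_fun do rewrite mxE /=; exact: measurable_cst.
  split => // mz; under eq_fun do rewrite dsgt_y0.
  by apply: measurable_dsgt_g => // i; exact: mz.
have mX : (forall i l, (l < k.+1)%N -> measurable_fun setT (fun w => z w i l)) ->
    measurable_mx (fun w => X (z w) k.+1).
  move=> mz; under eq_fun do rewrite dsgt_xS.
  apply: measurable_mxM; apply: measurable_mxB.
    by apply: IHx => i l lk; apply: mz; exact: ltnW.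
  by apply: measurable_mxZ; apply: IHy => i l lk; exact: mz.
split => // mz; under eq_fun do rewrite dsgt_yS.
apply: measurable_mxB; [apply: measurable_mxD|].
- by apply: measurable_mxM; apply: IHy => i l lk; apply: mz; exact: leqW.
- apply: measurable_dsgt_g => [i|]; first exact: mz.
  by apply: mX => i l lk; apply: mz; exact: ltnW.
- apply: measurable_dsgt_g => [i|]; first exact: mz.
  by apply: IHx => i l lk; apply: mz; rewrite ltnW// ltnW.
Qed.

End dsgt_recursion.

(** * Moments of the noise and of the iterates *)

Section stochastic_dsgt.
Context {R : realType} {d : measure_display} {T : measurableType d}
    (P : probability T R) {n p q : nat}
    (f : 'I_n -> 'rV[R]_p -> R) (mu L : R)
    (g : 'I_n -> 'rV[R]_p -> 'rV[R]_q -> 'rV[R]_p)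
    (xi : 'I_n -> nat -> {RV P >-> 'rV[R]_q}) (sigma : R)
    (e : rel 'I_n) (W : 'M[R]_n)
    (xstar : 'rV[R]_p) (x0 : 'I_n -> 'rV[R]_p) (alpha : nat -> R).
Hypotheses
    (hA1 : stochastic_gradient P f g xi sigma)
    (hL : 0 < L)
    (hconvex : forall i, strongly_convex mu (f i))
    (hsmooth : forall i, lipschitz_grad L (f i))
    (gstar : row_mean (grads f (replicate xstar)) = 0 :> 'rV[R]_p)
    (hA3 : undirected_connected e)
    (hA4 : mixing_matrix e W).

Let z (w : T) i l := xi i l w.
Let X w k := dsgt_x W alpha g x0 (z w) k.
Let Y w k := dsgt_y W alpha g x0 (z w) k.
Let G w k := dsgt_g W alpha g x0 (z w) k.
Let nu w k := G w k - grads f (X w k).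
Let n0 : (0 < n)%N := mixing_size_gt0 hA4.

Notation Ex F := (\int[P]_w (F w)%R).

Let mg i : measurable_fun setT (fun z : 'rV[R]_p * 'rV[R]_q => g i z.1 z.2).
Proof. by case: hA1. Qed.

Let mxi i l : measurable_fun setT (xi i l). Proof. by []. Qed.

Let mX k : measurable_mx (fun w => X w k).
Proof. by apply: (measurable_dsgt _ _ _ mg _ _).1 => i l _; exact: mxi. Qed.

Let gmean i k x j : ('E_P[fun w => (g i x (xi i k w) 0 j)%R] = (grad (f i) x 0 j)%:E)%E.
Proof. by case: hA1. Qed.

Let gvar i k x :
  ('E_P[fun w => (norm2 (g i x (xi i k w) - grad (f i) x) ^+ 2)%R] <= (sigma ^+ 2)%:E)%E.
Proof. by case: hA1. Qed.

Let mgrad i : measurable_fun setT (grad (f i)).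
Proof. exact: (measurable_mean_gradient (mg i) (gmean i 0) (gvar i 0)). Qed.

Let measurable_grads {d'} {E : measurableType d'} (A : E -> 'M[R]_(n, p)) :
  measurable_mx A -> measurable_mx (fun w => grads f (A w)).
Proof.
move=> mA i j; under eq_fun do rewrite mxE.
apply: (measurableT_comp (measurable_coord j)).
apply: (measurableT_comp (mgrad i)); exact: measurable_mx_row.
Qed.

Let Xs := fun ik : 'I_n * nat => xi ik.1 ik.2 : T -> 'rV[R]_q.

Let mXs ik : measurable_fun setT (Xs ik). Proof. exact: mxi. Qed.

(* T with the sigma-algebra generated by all samples but that of agent i at step k. *)
Notation E i k := (g_sigma_algebraType (cylinders_except Xs (i, k))).

Let indep i k : independent2 P (id : T -> E i k) (xi i k).
Proof.
have [_ hind _ _] := hA1.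
exact: (independent_except mXs hind (i0 := (i, k))).
Qed.

Let mid i k : measurable_fun setT (id : T -> E i k).
Proof. exact: measurable_id_except. Qed.

Let idE i k : T -> E i k := id.
HB.instance Definition _ i k := isMeasurableFun.Build _ _ _ _ (idE i k) (@mid i k).

Let mXE i k l : (l <= k)%N -> measurable_mx (fun w : E i k => X w l).
Proof.
move=> lk; apply: (measurable_dsgt _ _ _ mg _ _).1 => i' l' ll.
have ne : (i', l') != (i, k).
  by rewrite xpair_eqE negb_and (ltn_eqF (leq_trans ll lk)) orbT.
exact: (measurable_except (X := Xs) ne).
Qed.

Let nuE w k i j :
  nu w k i j = (g i (row i (X w k)) (xi i k w) - grad (f i) (row i (X w k))) 0 j.
Proof. by rewrite /nu /G /dsgt_g !mxE. Qed.

Let row_nu w k i :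
  row i (nu w k) = g i (row i (X w k)) (xi i k w) - grad (f i) (row i (X w k)).
Proof. by rewrite /nu /G linearB /= !rowK. Qed.

Let mXrow i k : measurable_fun setT (fun w : E i k => row i (X w k)).
Proof. by apply: measurable_mx_row; exact: mXE. Qed.

Lemma noise_L2 k : L2mx P (fun w => nu w k).
Proof.
move=> i j; under eq_fun do rewrite nuE.
exact: (noise_Lfun (Z := idE i k) (indep (i := i) (k := k)) (mg i)
  (gmean i k) (gvar i k) (@mXrow i k) j).
Qed.

Lemma noise_row_variance i k : Ex (fun w => sqnorm (row i (nu w k))) <= sigma ^+ 2.
Proof.
have L1nu : (fun w => sqnorm (row i (nu w k))) \in Lfun P 1.
  by apply: L2mx_sqnorm => i' j; under eq_fun do rewrite mxE; exact: noise_L2.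
rewrite -lee_fin -expectation_Rintegral//.
under eq_fun do rewrite row_nu.
exact: (noise_variance (Z := idE i k) (indep (i := i) (k := k)) (mg i)
  (gmean i k) (gvar i k) (@mXrow i k)).
Qed.

Lemma noise_total_variance k : Ex (fun w => sqnorm (nu w k)) <= n%:R * sigma ^+ 2.
Proof.
under eq_Rintegral do rewrite sqnorm_rows.
rewrite (Rexpectation_sum _).1 => [|i]; last first.
  by apply: L2mx_sqnorm => i' j; under eq_fun do rewrite mxE; exact: noise_L2.
rewrite mulr_natl -[in leRHS](card_ord n) -sumr_const.
by apply: ler_sum => i _; exact: noise_row_variance.
Qed.

(** [Phi] may depend on every sample except that of agent [i] at step [k], so both past quantities
    and the noise of other agents qualify. *)
Lemma noise_orthogonal i k j (Phi : T -> R) :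
  measurable_fun setT (Phi : E i k -> R) -> Phi \in Lfun P 2%:E ->
  Ex (fun w => Phi w * nu w k i j) = 0.
Proof.
move=> mPhi L2Phi; under eq_Rintegral do rewrite nuE.
exact: (noise_uncorrelated (Z := idE i k) (indep (i := i) (k := k)) (mg i)
  (gmean i k) (gvar i k) (@mXrow i k) j mPhi L2Phi).
Qed.

Let measurable_nu_except i i' k j : i' != i ->
  measurable_fun setT (fun w : E i k => nu w k i' j).
Proof.
move=> ii'; have mXk : measurable_mx (fun w : E i k => X w k) by exact: mXE.
have ne : (i', k) != (i, k) by rewrite xpair_eqE negb_and ii'.
have mpair : measurable_fun setT (fun w : E i k => (row i' (X w k), xi i' k w)).
  apply: measurable_fun_pair; first exact: measurable_mx_row.
  exact: (measurable_except (X := Xs) ne).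
under eq_fun do rewrite nuE mxE [X in _ + X]mxE; apply: measurable_funB.
  exact: (measurableT_comp (measurable_coord j) (measurableT_comp (mg i') mpair)).
have mgr := measurableT_comp (mgrad i') (measurable_mx_row i' mXk).
exact: (measurableT_comp (measurable_coord j) mgr).
Qed.

(* The cross terms vanish: the noise of another agent at the same step is
   independent of the sample of agent i. *)
Lemma noise_mean_variance k :
  Ex (fun w => sqnorm (row_mean (nu w k))) <= n%:R^-1 * sigma ^+ 2.
Proof.
have nL := noise_L2 k.
have L1p i i' j : (fun w => nu w k i j * nu w k i' j) \in Lfun P 1.
  exact: Lfun2_mul_Lfun1.
have expand w : sqnorm (row_mean (nu w k)) =
    n%:R^-1 ^+ 2 * \sum_j \sum_i \sum_i' nu w k i' j * nu w k i j.
  rewrite sqnorm_rV mulr_sumr; apply: eq_bigr => j _.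
  rewrite row_meanE exprMn expr2 [X in _ * X]expr2 mulr_sumr; congr (_ * _).
  by apply: eq_bigr => i _; rewrite mulr_suml.
have L1s j i : (fun w => \sum_i' nu w k i' j * nu w k i j) \in Lfun P 1.
  exact: (Rexpectation_sum (fun i' => L1p i' i j)).2.
have L1ss j : (fun w => \sum_i \sum_i' nu w k i' j * nu w k i j) \in Lfun P 1.
  exact: (Rexpectation_sum (L1s j)).2.
under eq_Rintegral do rewrite expand.
rewrite RexpectationZ; last exact: (Rexpectation_sum L1ss).2.
rewrite (Rexpectation_sum L1ss).1.
have -> : \sum_j Ex (fun w => \sum_i \sum_i' nu w k i' j * nu w k i j) =
    Ex (fun w => sqnorm (nu w k)).
  under [RHS]eq_Rintegral do rewrite sqnormE exchange_big.
  have L1d j : (fun w => \sum_i nu w k i j ^+ 2) \in Lfun P 1.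
    exact: (Rexpectation_sum (fun i => L1p i i j)).2.
  rewrite (Rexpectation_sum L1d).1; apply: eq_bigr => j _.
  rewrite (Rexpectation_sum (L1s j)).1 (Rexpectation_sum (fun i => L1p i i j)).1.
  apply: eq_bigr => i _; rewrite (Rexpectation_sum (fun i' => L1p i' i j)).1.
  rewrite (bigD1 i)//= big1 ?addr0// => i' ii'.
  by apply: noise_orthogonal; [exact: measurable_nu_except|exact: nL].
have nR0 : n%:R != 0 :> R by rewrite pnatr_eq0 -lt0n.
rewrite expr2 -mulrA ler_wpM2l ?invr_ge0// ler_pdivrMl ?ltr0n//.
exact: noise_total_variance.
Qed.

Let grads_L2 k : L2mx P (fun w => X w k) -> L2mx P (fun w => grads f (X w k)).
Proof.
move=> hX i j.
have L2d : L2mx P (fun w => grads f (X w k) - grads f (replicate xstar)).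
  apply: (@L2mx_dominated _ _ _ _ _ _ _ _ _ (fun w => X w k - replicate xstar) (L ^+ 2)).
  - apply: measurable_mxB; first exact: measurable_grads.
    by move=> i' j'; exact: measurable_cst.
  - by apply: L2mxB => //; exact: L2mx_cst.
  - by move=> w; exact: grads_lipschitz.
have := L2mxD L2d (L2mx_cst P (grads f (replicate xstar))) i j.
by under eq_fun do rewrite subrK.
Qed.

Let G_L2 k : L2mx P (fun w => X w k) -> L2mx P (fun w => G w k).
Proof.
move=> hX i j; have := L2mxD (noise_L2 k) (grads_L2 hX) i j.
by under eq_fun do rewrite subrK.
Qed.

Lemma iterates_L2 k : L2mx P (fun w => X w k) /\ L2mx P (fun w => Y w k).
Proof.
elim: k => [|k [hX hY]].
  have hX : L2mx P (fun w => X w 0).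
    by move=> i j; under eq_fun do rewrite mxE; exact: Lfun_cst.
  by split => // i j; under eq_fun do rewrite /Y dsgt_y0; exact: G_L2.
have hX' : L2mx P (fun w => X w k.+1).
  move=> i j; under eq_fun do rewrite /X dsgt_xS.
  by apply: L2mxM; apply: L2mxB => //; exact: L2mxZ.
split => // i j; under eq_fun do rewrite /Y dsgt_yS.
by apply: L2mxB; [apply: L2mxD; [exact: L2mxM|exact: G_L2]|exact: G_L2].
Qed.

(** The averaged step without its noise; it involves only samples before [k] and is thus orthogonal
    to the noise at [k]. *)
Let b w k := row_mean (X w k) - xstar - alpha k *: row_mean (grads f (X w k)).

Let b_L2 k : L2mx P (fun w => b w k).
Proof.
have [hX _] := iterates_L2 k.
apply: L2mxB; first by apply: L2mxB; [exact: L2mx_mean|exact: L2mx_cst].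
by apply: L2mxZ; apply: L2mx_mean; exact: grads_L2.
Qed.

Let mb i k j : measurable_fun setT (fun w : E i k => b w k 0 j).
Proof.
have mXk : measurable_mx (fun w : E i k => X w k) by exact: mXE.
have mmean (A : E i k -> 'M[R]_(n, p)) : measurable_mx A ->
    measurable_mx (fun w => row_mean (A w)).
  by move=> mA; apply: measurable_mxZ; exact: measurable_mxM.
have : measurable_mx (fun w : E i k => b w k); last exact.
apply: measurable_mxB; first apply: measurable_mxB.
- exact: mmean.
- by move=> i' j'; exact: measurable_cst.
- by apply: measurable_mxZ; apply: mmean; exact: measurable_grads.
Qed.

Lemma mean_iterateS w k : row_mean (X w k.+1) - xstar =
  b w k - alpha k *: row_mean (nu w k).
Proof.
rewrite /X dsgt_xS (row_mean_mix hA4) row_meanD row_meanN row_meanZ.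
rewrite (dsgt_tracking _ _ _ _ _ hA4) -/(X w k) -/(G w k).
have -> : G w k = nu w k + grads f (X w k) by rewrite /nu subrK.
rewrite /b row_meanD scalerDr; set u := alpha k *: _; set v := alpha k *: _.
by rewrite [LHS]addrAC opprD addrA; exact: addrAC.
Qed.

(** The cross term splits over agents and coordinates, and each piece vanishes by
    [noise_orthogonal]. What is left of the noise is its average, whence the 1/n. *)
Lemma mean_iterate_second_moment k :
  Ex (fun w => sqnorm (row_mean (X w k.+1) - xstar)) <=
  Ex (fun w => sqnorm (b w k)) + alpha k ^+ 2 * (n%:R^-1 * sigma ^+ 2).
Proof.
have nL := noise_L2 k; have bL := b_L2 k.
have L1b : (fun w => sqnorm (b w k)) \in Lfun P 1 by exact: L2mx_sqnorm.
have L1n : (fun w => sqnorm (row_mean (nu w k))) \in Lfun P 1.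
  by apply: L2mx_sqnorm; exact: L2mx_mean.
have L1p i j : (fun w => b w k 0 j * nu w k i j) \in Lfun P 1.
  exact: Lfun2_mul_Lfun1.
have L1s j := (Rexpectation_sum (fun i => L1p i j)).2.
have L1ss := (Rexpectation_sum L1s).2.
have expand w : sqnorm (row_mean (X w k.+1) - xstar) =
    sqnorm (b w k) + (alpha k ^+ 2 * sqnorm (row_mean (nu w k))
    + (- 2 * alpha k * n%:R^-1) * \sum_j \sum_i b w k 0 j * nu w k i j).
  rewrite mean_iterateS sqnorm_sub_scale dotvE.
  have -> : \sum_j row_mean (nu w k) 0 j * b w k 0 j =
     n%:R^-1 * \sum_j \sum_i b w k 0 j * nu w k i j.
    rewrite mulr_sumr; apply: eq_bigr => j _; rewrite row_meanE -mulrA mulr_suml.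
    by congr (_ * _); apply: eq_bigr => i _; rewrite mulrC.
  by ring.
under eq_Rintegral do rewrite expand.
rewrite RexpectationD//; last by apply: Lfun1D; exact: Lfun1Z.
rewrite lerD2l RexpectationD; [|exact: Lfun1Z|exact: Lfun1Z].
rewrite !RexpectationZ// (Rexpectation_sum L1s).1 [X in _ + _ * X]big1 ?mulr0 ?addr0.
  by rewrite ler_wpM2l ?sqr_ge0// noise_mean_variance.
move=> j _; rewrite (Rexpectation_sum (fun i => L1p i j)).1 big1// => i _.
by apply: noise_orthogonal; [exact: mb|exact: bL].
Qed.

Let L1dX k : (fun w => sqnorm (deviation (X w k))) \in Lfun P 1.
Proof. by apply: L2mx_sqnorm; apply: L2mx_deviation; have [] := iterates_L2 k. Qed.

Let L1dY k : (fun w => sqnorm (deviation (Y w k))) \in Lfun P 1.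
Proof. by apply: L2mx_sqnorm; apply: L2mx_deviation; have [] := iterates_L2 k. Qed.

Let L1x k : (fun w => sqnorm (row_mean (X w k) - xstar)) \in Lfun P 1.
Proof.
apply: L2mx_sqnorm; apply: L2mxB; last exact: L2mx_cst.
by apply: L2mx_mean; have [] := iterates_L2 k.
Qed.

Let L1nu k : (fun w => sqnorm (nu w k)) \in Lfun P 1.
Proof. by apply: L2mx_sqnorm; exact: noise_L2. Qed.

Lemma consensus_recursion (abar : R) : (forall k, 0 <= alpha k <= abar) ->
  exists r C : R, [/\ 0 <= r < 1, 0 <= C & forall k,
    Ex (fun w => sqnorm (deviation (X w k.+1))) <=
      r * Ex (fun w => sqnorm (deviation (X w k))) +
      C * (alpha k ^+ 2 * Ex (fun w => sqnorm (deviation (Y w k)))) /\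
    Ex (fun w => sqnorm (deviation (Y w k.+1))) <=
      r * Ex (fun w => sqnorm (deviation (Y w k))) +
      C * (2 * (n%:R * sigma ^+ 2) + Ex (fun w => sqnorm (deviation (X w k)))
        + alpha k ^+ 2 * Ex (fun w => sqnorm (deviation (Y w k)))
        + alpha k ^+ 2 * Ex (fun w => sqnorm (row_mean (X w k) - xstar)))].
Proof.
move=> halpha.
have [r [C [r01 C0 step]]] := consensus_step_bounds hA3 hA4 hsmooth hL gstar abar.
exists r, C; split; rewrite ?(ltW C0)// => k.
have GE w l : G w l = nu w l + grads f (X w l) by rewrite /nu subrK.
have hstep w : sqnorm (deviation (X w k.+1)) <= r * sqnorm (deviation (X w k))
     + C * (alpha k ^+ 2 * sqnorm (deviation (Y w k))) /\
  sqnorm (deviation (Y w k.+1)) <= r * sqnorm (deviation (Y w k))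
     + C * (sqnorm (nu w k) + sqnorm (nu w k.+1) + sqnorm (deviation (X w k))
       + alpha k ^+ 2 * sqnorm (deviation (Y w k))
       + alpha k ^+ 2 * sqnorm (row_mean (X w k) - xstar)).
  have tracking : row_mean (Y w k) = row_mean (nu w k + grads f (X w k)).
    by rewrite (dsgt_tracking _ _ _ _ _ hA4) -GE.
  have := step (alpha k) (X w k) (Y w k) (nu w k) (nu w k.+1) (halpha k) tracking.
  by rewrite /= -dsgt_xS -/(X w k.+1) -!GE -dsgt_yS.
split.
  have L1a : (fun w => alpha k ^+ 2 * sqnorm (deviation (Y w k))) \in Lfun P 1.
    exact: Lfun1Z.
  apply: le_trans (Rexpectation_le (L1dX k.+1) _ (fun w => (hstep w).1)) _.
    by apply: Lfun1D; exact: Lfun1Z.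
  rewrite RexpectationD; [|exact: Lfun1Z|exact: Lfun1Z].
  by rewrite !RexpectationZ.
have L1a : (fun w => alpha k ^+ 2 * sqnorm (deviation (Y w k))) \in Lfun P 1.
  exact: Lfun1Z.
have L1b : (fun w => alpha k ^+ 2 * sqnorm (row_mean (X w k) - xstar)) \in Lfun P 1.
  exact: Lfun1Z.
have L1c := Lfun1D (L1nu k) (L1nu k.+1).
have L1d := Lfun1D L1c (L1dX k).
have L1e := Lfun1D L1d L1a.
have L1f := Lfun1D L1e L1b.
apply: le_trans (Rexpectation_le (L1dY k.+1) _ (fun w => (hstep w).2)) _.
  by apply: Lfun1D; exact: Lfun1Z.
rewrite RexpectationD; [|exact: Lfun1Z|exact: Lfun1Z].
rewrite !RexpectationZ// lerD2l ler_wpM2l ?(ltW C0)//.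
rewrite (RexpectationD L1e L1b) (RexpectationD L1d L1a).
rewrite (RexpectationD L1c (L1dX k)) (RexpectationD (L1nu k) (L1nu k.+1)).
rewrite !RexpectationZ// !lerD2r.
by rewrite [leRHS]mulr_natl mulr2n; apply: lerD; exact: noise_total_variance.
Qed.

Lemma optimality_recursion : 0 < mu -> (forall k, 0 < alpha k) ->
  exists a0 Cu : R, [/\ 0 < a0, 0 <= Cu & forall k, alpha k <= a0 ->
    Ex (fun w => sqnorm (row_mean (X w k.+1) - xstar)) <=
      (1 - alpha k * mu) * Ex (fun w => sqnorm (row_mean (X w k) - xstar))
      + Cu * (alpha k * Ex (fun w => sqnorm (deviation (X w k))))
      + alpha k ^+ 2 * (n%:R^-1 * sigma ^+ 2)].
Proof.
(* Below this threshold both [4 * (a * L ^+ 2) <= mu] and [a * mu <= 1] hold. *)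
move=> mu0 alpha0; pose a0 := (4 * L ^+ 2 / mu + mu)^-1.
have q0 : 0 < 4 * L ^+ 2 / mu by rewrite divr_gt0// mulr_gt0// exprn_gt0.
have a00 : 0 < a0 by rewrite invr_gt0 addr_gt0.
pose Cu := (a0 + 2 / mu) * (n%:R^-1 * L ^+ 2).
have nL0 : 0 <= n%:R^-1 * L ^+ 2 by rewrite mulr_ge0 ?invr_ge0 ?sqr_ge0.
exists a0, Cu; split => //.
  by rewrite mulr_ge0// addr_ge0 ?(ltW a00)// divr_ge0// ltW.
move=> k ak; set a := alpha k; have ap : 0 < a := alpha0 k.
apply: le_trans (mean_iterate_second_moment k) _; rewrite -/a lerD2r.
have aq : a * (4 * L ^+ 2 / mu + mu) <= 1.
  by rewrite -ler_pdivlMr ?addr_gt0// mul1r.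
have aL : 4 * (a * L ^+ 2) <= mu.
  have h : a * (4 * L ^+ 2 / mu) <= 1.
    by apply: le_trans aq; rewrite mulrDr lerDl mulr_ge0// ltW.
  have -> : 4 * (a * L ^+ 2) = a * (4 * L ^+ 2 / mu) * mu by field; rewrite gt_eqF.
  by rewrite ler_piMl// ltW.
have am : a * mu <= 1.
  by apply: le_trans aq; rewrite mulrDr lerDr mulr_ge0// ltW.
(* The Young weight. The gain 2 a mu pays for it and for a^2 L^2, at most a mu/4, and still leaves a
   mu; its inverse, of order 1/a, lowers the a^2 before the deviation to order a. *)
have s0 : 0 < a * mu / 2 by rewrite divr_gt0// mulr_gt0.
have coef : (1 + a * mu / 2) * (1 - 2 * a * mu + a ^+ 2 * L ^+ 2) <= 1 - a * mu.
  have f1 := ler_wpM2l (ltW ap) aL.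
  have f2 := ler_wpM2r (mulr_ge0 (ltW ap) (ltW mu0)) aL.
  have f3 := ler_wpM2l (ltW ap) f2.
  have f4 := ler_wpM2l (mulr_ge0 (ltW ap) (ltW mu0)) am.
  have amp := mulr_gt0 ap mu0.
  have f5 := sqr_ge0 (a * mu).
  move: f1 f2 f3 f4 f5 amp; lra.
have coefV : (1 + (a * mu / 2)^-1) * a ^+ 2 <= (a0 + 2 / mu) * a.
  have -> : (1 + (a * mu / 2)^-1) * a ^+ 2 = (a + 2 / mu) * a.
    by field; rewrite !gt_eqF.
  by rewrite ler_wpM2r ?(ltW ap)// lerD2r.
have hb w : sqnorm (b w k) <= (1 - a * mu) * sqnorm (row_mean (X w k) - xstar)
    + (Cu * a) * sqnorm (deviation (X w k)).
  apply: le_trans (mean_step_bound hconvex hsmooth hL n0 gstar _ s0 (ltW ap)) _.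
  have d0 := sqnorm_ge0 (deviation (X w k)).
  apply: lerD; first by rewrite ler_wpM2r ?sqnorm_ge0.
  rewrite mulrA (mulrA _ _ (sqnorm _)) ler_wpM2r// /Cu [leRHS]mulrAC.
  by rewrite ler_wpM2r.
apply: le_trans (Rexpectation_le _ _ hb) _.
- exact/L2mx_sqnorm/b_L2.
- by apply: Lfun1D; exact: Lfun1Z.
- rewrite RexpectationD; [|exact: Lfun1Z|exact: Lfun1Z].
  by rewrite !RexpectationZ// mulrA.
Qed.

End stochastic_dsgt.

(** * Assembly of the recursions into the rates *)

Theorem theorem2 (R : realType) (d : measure_display) (T : measurableType d)
    (P : probability T R) (n p q : nat)
    (f : 'I_n -> 'rV[R]_p -> R) (mu L : R)
    (g : 'I_n -> 'rV[R]_p -> 'rV[R]_q -> 'rV[R]_p)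
    (xi : 'I_n -> nat -> {RV P >-> 'rV[R]_q}) (sigma : R)
    (e : rel 'I_n) (W : 'M[R]_n)
    (xstar : 'rV[R]_p) (x0 : 'I_n -> 'rV[R]_p) (theta m : R)
    (hsigma : 0 < sigma)
    (hA1 : stochastic_gradient P f g xi sigma)
    (hmu : 0 < mu) (hL : 0 < L)
    (hdiff : forall i x, differentiable (f i) x)
    (hconvex : forall i, strongly_convex mu (f i))
    (hsmooth : forall i, lipschitz_grad L (f i))
    (hxstar : forall x, avg f xstar <= avg f x)
    (hA3 : undirected_connected e)
    (hA4 : mixing_matrix e W)
    (htheta : mu^-1 < theta)
    (hm1 : stepsize_cond1 W mu L theta m)
    (hm2 : stepsize_cond2 W mu L theta m) :
  let alpha := fun k : nat => theta / (m + k%:R) in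
  let x := fun (k : nat) (w : T) => dsgt_x W alpha g x0 (fun i l => xi i l w) k in
  let xbar := fun (k : nat) (w : T) => row_mean (x k w) in
  exists c1 c2 c3 : R, forall k : nat,
    ('E_P[fun w => (norm2 (xbar k w - xstar) ^+ 2)%R]
       <= (2 * theta ^+ 2 * sigma ^+ 2 / (n%:R * (theta * mu - 1) * (m + k%:R))
           + c1 / (m + k%:R) `^ (theta * mu)
           + c2 / (m + k%:R) ^+ 2)%R%:E)%E /\
    ('E_P[fun w => (norm2 (x k w - (const_mx 1 : 'cV[R]_n) *m xbar k w) ^+ 2)%R]
       <= (c3 / (m + k%:R) ^+ 2)%R%:E)%E.
Proof.
move=> alpha x xbar.
have n0 := mixing_size_gt0 hA4.
have theta0 : 0 < theta by apply: lt_trans htheta; rewrite invr_gt0.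
have thetamu : 1 < theta * mu by rewrite -ltr_pdivrMr// div1r.
have m0 : 0 < m.
  apply: le_lt_trans hm1; rewrite le_max; apply/orP; left.
  by rewrite mulr_ge0 ?divr_ge0 ?addr_ge0 ?ltW.
have t0 k : 0 < m + k%:R by rewrite ltr_wpDr.
have alpha0 k : 0 < alpha k by rewrite divr_gt0.
have alpha_le k : 0 <= alpha k <= theta / m.
  by rewrite ltW//= ler_pM2l// lef_pV2 ?posrE// lerDl.
have gstar : row_mean (grads f (replicate xstar)) = 0 :> 'rV[R]_p.
  apply/rowP => j; rewrite row_meanE [RHS]mxE.
  have /rowP/(_ j) := stationary n0 hdiff hxstar; rewrite summxE [in RHS]mxE => h.
  rewrite (eq_bigr (fun i => grad (f i) xstar 0 j)) ?h ?mulr0// => i _.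
  by rewrite mxE row_replicate.
have [r [C [r01 C0 hVY]]] :=
  consensus_recursion x0 hA1 hL hsmooth gstar hA3 hA4 alpha_le.
have [a0 [Cu [a00 Cu0 hU]]] :=
  optimality_recursion x0 hA1 hL hconvex hsmooth gstar hA4 hmu alpha0.
(* The variance bound of the averaged noise; as [b] in the rate lemmas it puts sigma^2/n into the
   leading term. *)
have b0 : 0 < n%:R^-1 * sigma ^+ 2 by rewrite mulr_gt0 ?invr_gt0 ?ltr0n// exprn_gt0.
have s20 : 0 <= 2 * (n%:R * sigma ^+ 2) by rewrite mulr_ge0// mulr_ge0// sqr_ge0.
have U0 k : 0 <= \int[P]_w sqnorm (xbar k w - xstar).
  by apply: Rexpectation_ge0 => w; exact: sqr_ge0.
have V0 k : 0 <= \int[P]_w sqnorm (deviation (x k w)).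
  by apply: Rexpectation_ge0 => w; exact: sqr_ge0.
pose y k w := dsgt_y W alpha g x0 (fun i l => xi i l w) k.
have Y0 k : 0 <= \int[P]_w sqnorm (deviation (y k w)).
  by apply: Rexpectation_ge0 => w; exact: sqr_ge0.
have HV k := (hVY k).1; have HY k := (hVY k).2.
have [c3 _ hc3] := consensus_rate U0 V0 Y0 m0 theta0 hmu r01 C0 Cu0 s20 b0 a00 HV HY hU.
have [c1 hc1] :=
  optimality_rate U0 V0 Y0 m0 theta0 hmu r01 C0 Cu0 s20 b0 a00 HV HY hU thetamu.
(* [c2] can be 0: the t^-3 source is absorbed by the factor 2 of the leading term, and the initial
   steps by [c1]. *)
exists c1, 0, c3 => k.
have [hX _] := iterates_L2 W xstar x0 alpha hA1 hL hsmooth k.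
split.
  rewrite expectation_Rintegral; last first.
    by apply: L2mx_sqnorm; apply: L2mxB; [exact: L2mx_mean|exact: L2mx_cst].
  rewrite lee_fin mul0r addr0; apply: le_trans (hc1 k) _; rewrite lerD2r.
  rewrite le_eqVlt; apply/orP; left; apply/eqP; field.
  by rewrite !gt_eqF ?subr_gt0 ?ltr0n.
rewrite expectation_Rintegral; last exact/L2mx_sqnorm/L2mx_deviation.
by rewrite lee_fin; exact: hc3.
Qed.
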